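(* Let $\mathfrak g=\mathfrak{spe}(n)$, let $V=\Bbbk^{n|n}$ be its matrix representation, equipped with the $\mathfrak g$-invariant non-degenerate odd symmetric bilinear form $B$, and let $x\in\mathfrak g_{\bar 1}$ be $\mathrm{ad}$-nilpotent. The element $x$ is distinguished in $\mathfrak g$ if and only if the $\Bbbk[x]$-module $V$ decomposes as $V=\bigoplus_{i=1}^pU_i\oplus W$ where (a) the $U_i$ and $W$ are mutually orthogonal (with respect to $B$), pairwise non-isomorphic $\Bbbk[x]$-summands; (b) the $U_i$ are indecomposable $\Bbbk[x]$-modules with $\dim U_i\in 2\mathbb Z$; (c) $W=W'\oplus\Pi(W')^*$ with $\dim W'\in 2\mathbb Z+1$, and both $W'$ and $\Pi(W')^*$ are isotropic (with respect to $B$) indecomposable $\Bbbk[x]$-modules.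
   Context: Base field $\Bbbk$: algebraically closed of characteristic $0$. $\mathfrak{pe}(n)\subset\mathfrak{gl}(n|n)$ is the Lie sub-superalgebra preserving a non-degenerate odd symmetric bilinear form $B$ on $\Bbbk^{n|n}$, and $\mathfrak{spe}(n)=\mathfrak{pe}(n)\cap\mathfrak{sl}(n|n)$, where $\mathfrak{sl}(n|n)$ consists of the endomorphisms of supertrace zero. A ''$\Bbbk[x]$-module'' is a vector superspace with the action of the odd operator $x$; isomorphisms are parity-preserving; $\Pi$ is the change of parity and $(-)^*$ the dual module. $\dim$ denotes the total dimension (even plus odd part). An odd element $x\in\mathfrak g_{\bar 1}$ is $\mathrm{ad}$-nilpotent if $[x,x]$ is a nilpotent element of the reductive Lie algebra $\mathfrak g_{\bar 0}$. It is distinguished if the set of semisimple elements of $\mathfrak g_{\bar 0}$ commuting with $x$ equals $Z(\mathfrak g)_{\bar 0}$, where $Z(\mathfrak g)$ is the center of $\mathfrak g$.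
   Formalization: The summand W is allowed to be zero, and (c) is required only when W is nonzero; with W forced nonzero the equivalence fails, e.g. for n = 1 and x a nonzero nilpotent odd element, which is distinguished while V is indecomposable of dimension 2. *)

(* Defs.v *)
From HB Require Import structures.
From mathcomp Require Import all_boot all_order all_algebra.

Set Implicit Arguments.
Unset Strict Implicit.
Unset Printing Implicit Defensive.

Import GRing.Theory.
Local Open Scope ring_scope.

(* A k[x]-module is a superspace with an odd operator.
   Parities are booleans: false = even, true = odd. *)

Record kxmod (K : fieldType) := KxMod {
  kx_car :> vectType K;
  kx_gr : bool -> {vspace kx_car};
  kx_act : 'End(kx_car);
  kx_gr_add : (kx_gr false + kx_gr true)%VS = fullv;
  kx_gr_cap : (kx_gr false :&: kx_gr true)%VS = 0%VS;
  kx_act_odd : forall b, (kx_act @: kx_gr b <= kx_gr (~~ b))%VS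
}.

Definition kx_iso (K : fieldType) (M N : kxmod K) : Prop :=
  exists f : 'Hom(M, N),
    [/\ bijective f,
        forall v, f (kx_act M v) = kx_act N (f v)
      & forall b v, v \in kx_gr M b -> f v \in kx_gr N b].

Record submod (K : fieldType) (M : kxmod K) := SubMod {
  sm_space :> {vspace M};
  sm_graded :
    (sm_space :&: kx_gr M false + sm_space :&: kx_gr M true)%VS = sm_space;
  sm_stable : (kx_act M @: sm_space <= sm_space)%VS
}.

Section SubModule.
Variables (K : fieldType) (M : kxmod K) (U : submod M).

Let S : vectType K := subvs_of U.
Definition sub_incl : 'Hom(S, M) := linfun (vsval : S -> M).
Definition sub_gr (b : bool) : {vspace S} := (sub_incl @^-1: kx_gr M b)%VS.
Definition sub_act : 'End(S) :=
  (linfun (vsproj U : M -> S) \o kx_act M \o sub_incl)%VF.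

Lemma sub_inclE (u : S) : sub_incl u = vsval u.
Proof. by rewrite /sub_incl lfunE. Qed.

Lemma mem_sub_gr b (u : S) : (u \in sub_gr b) = (vsval u \in kx_gr M b).
Proof. by rewrite -memv_preim sub_inclE. Qed.

Lemma sub_actE (u : S) : vsval (sub_act u) = kx_act M (vsval u).
Proof.
rewrite /sub_act !comp_lfunE /= sub_inclE lfunE /= vsprojK //.
by apply: (subvP (sm_stable U)); rewrite memv_img // subvsP.
Qed.

Lemma sub_gr_add : (sub_gr false + sub_gr true)%VS = fullv.
Proof.
apply/eqP; rewrite eqEsubv subvf /=; apply/subvP => u _.
have := subvsP u; rewrite -{2}(sm_graded U).
case/memv_addP => a /memv_capP [aU aE] [b /memv_capP [bU bO] Eab].
apply/memv_addP; exists (vsproj U a); first by rewrite mem_sub_gr vsprojK.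
exists (vsproj U b); first by rewrite mem_sub_gr vsprojK.
by apply/subvs_inj; rewrite linearD /= !vsprojK.
Qed.

Lemma sub_gr_cap : (sub_gr false :&: sub_gr true)%VS = 0%VS.
Proof.
apply/eqP; rewrite -subv0; apply/subvP => u; rewrite memv_cap !mem_sub_gr.
by rewrite -memv_cap kx_gr_cap !memv0 -(inj_eq subvs_inj) linear0.
Qed.

Lemma sub_act_odd b : (sub_act @: sub_gr b <= sub_gr (~~ b))%VS.
Proof.
apply/subvP => _ /memv_imgP [u ub ->]; rewrite mem_sub_gr sub_actE.
by apply: (subvP (kx_act_odd M b)); rewrite memv_img // -mem_sub_gr.
Qed.

Definition kx_sub : kxmod K := KxMod sub_gr_add sub_gr_cap sub_act_odd.

End SubModule.

(* x acts on Pi M by -x, as x is odd. *)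
Section Parity.
Variables (K : fieldType) (M : kxmod K).

Lemma pi_gr_add :
  (kx_gr M (~~ false) + kx_gr M (~~ true))%VS = (fullv : {vspace M}).
Proof. by rewrite addvC kx_gr_add. Qed.

Lemma pi_gr_cap : (kx_gr M (~~ false) :&: kx_gr M (~~ true))%VS = 0%VS.
Proof. by rewrite capvC kx_gr_cap. Qed.

Lemma pi_act_odd b :
  ((- kx_act M) @: kx_gr M (~~ b) <= kx_gr M (~~ ~~ b))%VS.
Proof.
apply/subvP => _ /memv_imgP [u ub ->]; rewrite opp_lfunE memvN.
by apply: (subvP (kx_act_odd M (~~ b))); rewrite memv_img.
Qed.

Definition kx_pi : kxmod K :=
  @KxMod K M (fun b => kx_gr M (~~ b)) (- kx_act M)
    pi_gr_add pi_gr_cap pi_act_odd.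

End Parity.

(* In the dual, a functional of parity b vanishes on vectors of parity ~~ b, and
   (x f) v = - (-1)^|f| f (x v). *)
Section Dual.
Variables (K : fieldType) (M : kxmod K).

Let D : vectType K := 'Hom(M, (K^o : vectType K)).

Definition gr_proj (b : bool) : 'End(M) := daddv_pi (kx_gr M b) (kx_gr M (~~ b)).

Definition precomp (g : 'End(M)) (f : D) : D := (f \o g)%VF.

Fact precomp_is_linear g : linear (precomp g).
Proof.
move=> a f1 f2; apply/lfunP => v.
by rewrite add_lfunE scale_lfunE !comp_lfunE add_lfunE scale_lfunE.
Qed.

HB.instance Definition _ g :=
  GRing.isLinear.Build K D D _ (precomp g) (precomp_is_linear g).

Definition dual_gr (b : bool) : {vspace D} :=
  lker (linfun (precomp (gr_proj (~~ b)))).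

(* f \o (p_0 - p_1) is (-1)^|f| f on homogeneous f. *)
Definition dual_act : 'End(D) :=
  linfun (precomp (- ((gr_proj false - gr_proj true) \o kx_act M))%VF).

Lemma gr_capb b : (kx_gr M b :&: kx_gr M (~~ b))%VS = 0%VS.
Proof. by case: b; rewrite ?kx_gr_cap // capvC kx_gr_cap. Qed.

Lemma gr_proj_id b v : v \in kx_gr M b -> gr_proj b v = v.
Proof. by move=> vb; rewrite /gr_proj daddv_pi_id ?gr_capb. Qed.

Lemma gr_proj_mem b v : gr_proj b v \in kx_gr M b.
Proof. exact: memv_pi. Qed.

Lemma gr_proj_add v : gr_proj false v + gr_proj true v = v.
Proof. by rewrite /gr_proj daddv_pi_add ?gr_capb // kx_gr_add memvf. Qed.

Lemma gr_proj_0 b v : v \in kx_gr M (~~ b) -> gr_proj b v = 0.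
Proof.
move=> vb; have := gr_proj_add v.
by case: b vb => vb; rewrite (gr_proj_id vb) => /eqP;
  rewrite -subr_eq0 ?[v + _]addrC addrK => /eqP.
Qed.

Lemma dual_grP b (f : D) :
  reflect (forall v, v \in kx_gr M (~~ b) -> f v = 0) (f \in dual_gr b).
Proof.
rewrite memv_ker lfunE /=; apply: (iffP eqP) => [f0 v vb | f0].
  by have /lfunP/(_ v) := f0; rewrite comp_lfunE gr_proj_id // lfunE.
by apply/lfunP => v; rewrite comp_lfunE f0 ?gr_proj_mem // lfunE.
Qed.

Lemma dual_actE b (f : D) v :
  f \in dual_gr b -> dual_act f v = - ((-1) ^+ b * f (kx_act M v)).
Proof.
move=> /dual_grP fb; rewrite lfunE /= comp_lfunE opp_lfunE linearN /=; congr (- _).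
rewrite comp_lfunE add_lfunE opp_lfunE linearB /=.
rewrite -{3}(gr_proj_add (kx_act M v)) linearD /=.
case: b fb => fb.
  by rewrite (fb (gr_proj false _)) ?gr_proj_mem // !add0r mulN1r.
by rewrite (fb (gr_proj true _)) ?gr_proj_mem // subr0 addr0 mul1r.
Qed.

Lemma dual_gr_add : (dual_gr false + dual_gr true)%VS = fullv.
Proof.
apply/eqP; rewrite eqEsubv subvf /=; apply/subvP => f _; apply/memv_addP.
exists (precomp (gr_proj false) f).
  by apply/dual_grP => v vb; rewrite comp_lfunE gr_proj_0 ?linear0.
exists (precomp (gr_proj true) f).
  by apply/dual_grP => v vb; rewrite comp_lfunE gr_proj_0 ?linear0.
by apply/lfunP => v; rewrite add_lfunE !comp_lfunE -linearD gr_proj_add.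
Qed.

Lemma dual_gr_cap : (dual_gr false :&: dual_gr true)%VS = 0%VS.
Proof.
apply/eqP; rewrite -subv0; apply/subvP => f /memv_capP [/dual_grP f0 /dual_grP f1].
rewrite memv0; apply/eqP/lfunP => v; rewrite zero_lfunE -(gr_proj_add v) linearD /=.
by rewrite f1 ?f0 ?addr0 ?gr_proj_mem.
Qed.

Lemma dual_act_odd b : (dual_act @: dual_gr b <= dual_gr (~~ b))%VS.
Proof.
apply/subvP => _ /memv_imgP [f fb ->]; apply/dual_grP => v; rewrite negbK => vb.
rewrite (dual_actE v fb); move/dual_grP: fb => ->; rewrite ?mulr0 ?oppr0 //.
by apply: (subvP (kx_act_odd M b)); rewrite memv_img.
Qed.

Definition kx_dual : kxmod K := KxMod dual_gr_add dual_gr_cap dual_act_odd.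

End Dual.

Definition indecomposable (K : fieldType) (M : kxmod K) : Prop :=
  (fullv : {vspace M}) <> 0%VS /\
  forall A B : submod M,
    (A + B)%VS = (fullv : {vspace M}) -> directv (A + B) ->
    sm_space A = 0%VS \/ sm_space B = 0%VS.

(* 'cV[K]_(n + n) is k^{n|n}: the first n coordinates are even, the last n odd;
   'M[K]_(n + n) is gl(n|n), acting by X *m v. *)

Section Gl.
Variables (K : fieldType) (n : nat).

Definition std_gr (b : bool) : {vspace 'cV[K]_(n + n)} :=
  if b then lker (linfun (usubmx : 'cV[K]_(n + n) -> 'cV[K]_n))
       else lker (linfun (dsubmx : 'cV[K]_(n + n) -> 'cV[K]_n)).
Arguments std_gr : simpl never.

Definition part (b : bool) (X : 'M[K]_(n + n)) : 'M[K]_(n + n) :=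
  if b then block_mx 0 (ursubmx X) (dlsubmx X) 0
       else block_mx (ulsubmx X) 0 0 (drsubmx X).

Definition homog (b : bool) (X : 'M[K]_(n + n)) : Prop := part b X = X.

(* [X, Y] = X Y - (-1)^(|X||Y|) Y X, extended bilinearly. *)
Definition sbracket (X Y : 'M[K]_(n + n)) : 'M[K]_(n + n) :=
  \sum_(a : bool) \sum_(b : bool)
    (part a X *m part b Y - (-1) ^+ (a && b) *: (part b Y *m part a X)).

Definition str (X : 'M[K]_(n + n)) : K := \tr (ulsubmx X) - \tr (drsubmx X).

Lemma std_grP b (v : 'cV[K]_(n + n)) :
  reflect ((if b then usubmx v else dsubmx v) = 0) (v \in std_gr b).
Proof. by case: b; rewrite memv_ker lfunE /=; apply: eqP. Qed.

Lemma std_gr_add : (std_gr false + std_gr true)%VS = fullv.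
Proof.
apply/eqP; rewrite eqEsubv subvf /=; apply/subvP => v _; apply/memv_addP.
exists (col_mx (usubmx v) 0); first by apply/std_grP; rewrite col_mxKd.
exists (col_mx 0 (dsubmx v)); first by apply/std_grP; rewrite col_mxKu.
by rewrite add_col_mx addr0 add0r vsubmxK.
Qed.

Lemma std_gr_cap : (std_gr false :&: std_gr true)%VS = 0%VS.
Proof.
apply/eqP; rewrite -subv0; apply/subvP => v /memv_capP [/std_grP v0 /std_grP v1].
by rewrite memv0 -[v]vsubmxK v0 v1 col_mx0.
Qed.

Lemma std_act_odd (x : 'M[K]_(n + n)) (hx : homog true x) b :
  (linfun (mulmx x : 'cV[K]_(n + n) -> 'cV[K]_(n + n)) @: std_gr b
     <= std_gr (~~ b))%VS.
Proof.
apply/subvP => _ /memv_imgP [v /std_grP vb ->]; rewrite lfunE /=; apply/std_grP.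
rewrite -hx -[v]vsubmxK /part mul_block_col !mul0mx add0r addr0.
by case: b vb => /= ->; rewrite ?col_mxKu ?col_mxKd mulmx0.
Qed.

Definition std_mod (x : 'M[K]_(n + n)) (hx : homog true x) : kxmod K :=
  KxMod std_gr_add std_gr_cap (std_act_odd hx).

End Gl.

Section Spe.
Variables (K : fieldType) (n : nat) (B : {biscalar 'cV[K]_(n + n)}).

Definition odd_form : Prop :=
  forall b v w, v \in std_gr K n b -> w \in std_gr K n b -> B v w = 0.

Definition supersymmetric_form : Prop :=
  forall a b v w, v \in std_gr K n a -> w \in std_gr K n b ->
    B v w = (-1) ^+ (a && b) * B w v.

Definition nondegenerate_form : Prop :=
  forall v, (forall w, B v w = 0) -> v = 0.

(* B (X v, w) + (-1)^(|X||v|) B (v, X w) = 0 for each homogeneous component of X. *)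
Definition pe (X : 'M[K]_(n + n)) : Prop :=
  forall a b v w, v \in std_gr K n b ->
    B (part a X *m v) w + (-1) ^+ (a && b) * B v (part a X *m w) = 0.

Definition spe (X : 'M[K]_(n + n)) : Prop := pe X /\ str X = 0.

Definition orthogonal_spaces (U W : {vspace 'cV[K]_(n + n)}) : Prop :=
  forall u w, u \in U -> w \in W -> B u w = 0.

Definition isotropic (U : {vspace 'cV[K]_(n + n)}) : Prop :=
  orthogonal_spaces U U.

End Spe.

(* Nilpotent and semisimple elements of the reductive (linear) Lie algebra g_0
   are those acting nilpotently, resp. diagonalizably, on k^{n|n}; for the
   latter the base field is meant to be algebraically closed. *)

Section Distinguished.
Variables (K : fieldType) (n : nat) (g : 'M[K]_(n + n) -> Prop).

Definition ad_nilpotent (x : 'M[K]_(n + n)) : Prop :=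
  exists k, sbracket x x ^+ k = 0.

Definition center (z : 'M[K]_(n + n)) : Prop :=
  g z /\ forall y, g y -> sbracket z y = 0.

Definition distinguished (x : 'M[K]_(n + n)) : Prop :=
  forall h,
    [/\ g h, homog false h, diagonalizable h & sbracket h x = 0]
    <-> center h /\ homog false h.

End Distinguished.

Section Decomposition.
Variables (K : fieldType) (n : nat) (B : {biscalar 'cV[K]_(n + n)}).
Variables (x : 'M[K]_(n + n)) (hx : homog true x).
Let V := std_mod hx.

Definition odd_summand (W : submod V) : Prop :=
  exists W' W'' : submod V,
    [/\ (W' + W'')%VS = sm_space W /\ directv (W' + W''),
        kx_iso (kx_sub W'') (kx_pi (kx_dual (kx_sub W'))),
        odd (\dim W'),
        isotropic B W' /\ isotropic B W''
      & indecomposable (kx_sub W') /\ indecomposable (kx_sub W'')].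

(* The summand W may be absent: a nonzero odd x in spe(1) is distinguished, as
   spe(1)_0 = 0, while V is then indecomposable of dimension 2. *)
Definition distinguished_decomposition : Prop :=
  exists (p : nat) (U : 'I_p -> submod V) (W : submod V),
    [/\ (\sum_(i < p) U i + W)%VS = fullv /\ directv (\sum_(i < p) U i + W),
        (forall i j, i != j -> orthogonal_spaces B (U i) (U j)) /\
        (forall i, orthogonal_spaces B (U i) W),
        (forall i j, i != j -> ~ kx_iso (kx_sub (U i)) (kx_sub (U j))) /\
        (forall i, ~ kx_iso (kx_sub (U i)) (kx_sub W)),
        forall i, indecomposable (kx_sub (U i)) /\ ~~ odd (\dim (U i))
      & sm_space W = 0%VS \/ odd_summand W].

End Decomposition.

(* Main.v *)
(* In matrix terms, C is the algebra of even endomorphisms of V commuting with x,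
   and T |-> T^* is the adjunction for B, an anti-involution of C. Submodules with a
   complement are images of idempotents of C, indecomposable ones correspond to
   primitive idempotents, and the even elements of spe(n) commuting with x are the
   h in C with h^* = - h and supertrace 0. As the even part of the center is 0, x is
   distinguished iff no such h <> 0 is diagonalizable.
   - If there is no such h, an idempotent e <> 0 with e e^* = e^* e = 0 has nonzero
   supertrace (take h = e - e^* ), and no two such pairs (e, e^* ) are orthogonal
   (take a combination of e - e^* and f - f^* ). So there is at most one, f, and it
   is primitive; split 1 - f - f^* into minimal self-adjoint idempotents. A
   non-nilpotent skew element has a generalized eigenprojection e with
   e e^* = e^* e = 0, so all skew elements below 1 - f - f^* are nilpotent, which
   forces the summands to be primitive and pairwise inequivalent.
   - Conversely, let e_i be the primitive idempotents of the decomposition. Each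
   e_i h e_i is nilpotent, by skewness and the vanishing of the supertrace, and for
   i <> j inequivalence makes (e_i h e_j)(e_j T e_i) nilpotent for T in C. Hence
   tr (h T) = 0 for all T in C, so h is nilpotent. *)
Require Import Defs.
From HB Require Import structures.
From mathcomp Require Import all_boot all_order all_algebra.
From Stdlib Require Import Classical_Prop.

Set Implicit Arguments.
Unset Strict Implicit.
Unset Printing Implicit Defensive.

Import GRing.Theory.
Local Open Scope ring_scope.

(** * Fitting decomposition, nilpotent and diagonalizable matrices *)

Section Matrices.
Variables (K : closedFieldType) (N : nat).
Implicit Types T e h : 'M[K]_N.

(** Write $\chi_T X = q X^k$ with $q$ prime to $X$. Bezout $uq + vX^k = 1$ gives [e] $= (uq)(T)$,
    the projection onto the generalized kernel of [T], and [S] $= (vX^{k-1})(T)$, an inverse of [T]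
    on the complement. Being polynomials in [T], both commute with whatever commutes with [T]. *)
Lemma fitting T : exists e S k,
  [/\ e * e = e, T ^+ k * e = 0, S * T = 1 - e
    & forall Y, Y * T = T * Y -> Y * e = e * Y /\ Y * S = S * Y].
Proof.
case: N T => [|m] T.
  have M0 (A B : 'M[K]_0) : A = B by rewrite [A]flatmx0 [B]flatmx0.
  by exists 0, 0, 0%N; split=> [|||Y _]; try split; exact: M0.
(* The extra factor ['X] guarantees [0 < k], which ['X^(k.-1)] below relies on. *)
have cT0 : char_poly T * 'X != 0.
  by rewrite mulf_neq0 ?polyX_eq0 // monic_neq0 ?char_poly_monic.
have [k [q q0 Dq]] := multiplicity_XsubC (char_poly T * 'X) 0.
rewrite polyC0 subr0 cT0 /= in q0 Dq.
have hT0 : horner_mx T (q * 'X^k) = 0.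
  by rewrite -Dq rmorphM /= Cayley_Hamilton mul0r.
have k_gt0 : (0 < k)%N.
  rewrite lt0n; apply: contraNneq q0 => k0.
  by rewrite k0 expr0 mulr1 in Dq; rewrite -Dq rootM rootX eqxx orbT.
have /Bezout_eq1_coprimepP [[u v] /= uv1] : coprimep q 'X^k.
  by rewrite coprimep_expr // coprimepX.
exists (horner_mx T (u * q)), (horner_mx T (v * 'X^(k.-1))), k.
have ST : horner_mx T (v * 'X^(k.-1)) * T = 1 - horner_mx T (u * q).
  rewrite -[X in _ * X](horner_mx_X T) -!rmorphM -(rmorph1 (horner_mx T)) -rmorphB.
  by congr (horner_mx T _); rewrite -uv1 [u * q + _]addrC addrK -mulrA -exprSr prednK.
split=> // [||Y YT].
- suff E0 : horner_mx T (u * q) * (1 - horner_mx T (u * q)) = 0.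
    by apply/eqP; rewrite -subr_eq0 -oppr_eq0 opprB -[X in X - _]mulr1 -mulrBr E0.
  rewrite -ST -[X in _ * (_ * X)](horner_mx_X T) -!rmorphM /=.
  rewrite (_ : u * q * _ = u * v * (q * 'X^k)).
    by rewrite rmorphM /= hT0 mulr0.
  by rewrite -{2}(prednK k_gt0) exprSr -!mulrA; congr (_ * _); rewrite mulrCA.
- rewrite -[X in X ^+ _](horner_mx_X T) -rmorphXn -rmorphM /=.
  by rewrite mulrC -mulrA rmorphM /= hT0 mulr0.
- have YTc : comm_mx Y T by [].
  by split; exact: comm_mx_horner.
Qed.

Lemma char_poly_eigen0 T :
  (forall a (v : 'rV[K]_N), v *m T = a *: v -> v != 0 -> a = 0) ->
  char_poly T = 'X^N.
Proof.
move=> ev0; have [r Dr] := closed_field_poly_normal (char_poly T).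
have := char_poly_monic T; rewrite monicE => /eqP lc1.
rewrite lc1 scale1r in Dr.
have r0 a : a \in r -> a = 0.
  move=> ra; have /eigenvalueP [v] : eigenvalue T a.
    by rewrite eigenvalue_root_char Dr root_prod_XsubC.
  exact: ev0.
have := size_char_poly T; rewrite Dr size_prod_XsubC => -[<-].
elim: r r0 {Dr} => [|a r IHr] r0; first by rewrite big_nil expr0.
rewrite big_cons IHr => [|b rb]; last by apply: r0; rewrite inE rb orbT.
by rewrite (r0 a) ?mem_head // subr0 -exprS.
Qed.

Lemma nilp_eigen T :
  (forall a (v : 'rV[K]_N), v *m T = a *: v -> v != 0 -> a = 0) ->
  exists k, T ^+ k = 0.
Proof.
move=> /char_poly_eigen0; case: N T => [|m] T cT.
  by exists 0%N; exact: flatmx0.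
exists m.+1; have := Cayley_Hamilton T.
by rewrite cT rmorphXn /= horner_mx_X.
Qed.

Lemma eigen_nilp T k : T ^+ k = 0 ->
  forall a (v : 'rV[K]_N), v *m T = a *: v -> v != 0 -> a = 0.
Proof.
move=> Tk a v va v0; have vk : v *m (T ^+ k) = a ^+ k *: v.
  elim: k {Tk} => [|k IHk]; first by rewrite !expr0 mulmx1 scale1r.
  by rewrite exprSr mulmxA IHk -scalemxAl va scalerA -exprSr.
move: vk; rewrite Tk mulmx0 => /esym/eqP; rewrite scaler_eq0 (negPf v0) orbF.
by rewrite expf_eq0 => /andP [_ /eqP].
Qed.

Lemma nilp_trace T k : T ^+ k = 0 -> \tr T = 0.
Proof.
move=> /eigen_nilp /char_poly_eigen0; case: N T => [|m] T cT.
  by rewrite [T]flatmx0 mxtrace0.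
have := char_poly_trace T (ltn0Sn m).
by rewrite cT coefXn /= (ltn_eqF (ltnSn m)) => /esym/eqP; rewrite oppr_eq0 => /eqP.
Qed.

Lemma nilp_or_eigen T : (exists k, T ^+ k = 0) \/
  exists a (v : 'rV[K]_N), [/\ v *m T = a *: v, v != 0 & a != 0].
Proof.
have [r Dr] := closed_field_poly_normal (char_poly T).
have lc1 : lead_coef (char_poly T) = 1 by apply/eqP; rewrite -monicE char_poly_monic.
rewrite lc1 scale1r in Dr.
have [/allP r0|/allPn [a ra a0]] := boolP (all (pred1 0) r); last first.
  have /eigenvalueP [v va v0] : eigenvalue T a.
    by rewrite eigenvalue_root_char Dr root_prod_XsubC.
  by right; exists a, v.
left; apply: nilp_eigen => a v va v0; apply/eqP/r0.
rewrite -root_prod_XsubC -Dr -eigenvalue_root_char.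
by apply/eigenvalueP; exists v.
Qed.

(** A rank factorization $e = CR$ of an idempotent has $RC = 1$, so $\operatorname{tr} e =
    \operatorname{tr} RC$. *)
Lemma idem_trace e : e * e = e -> \tr e = (\rank e)%:R.
Proof.
move=> ee; have [A AC] : exists A, A *m col_base e = 1%:M.
  by apply/row_fullP/col_base_full.
have [A' RA'] : exists A', row_base e *m A' = 1%:M.
  by apply/row_freeP/row_base_free.
have De : e = col_base e *m row_base e by rewrite mulmx_base.
have eme : e *m e = e by [].
move: (col_base e) (row_base e) A A' De AC RA' => C R A A' De AC RA'.
have RC : R *m C = 1%:M.
  have : A *m (C *m R *m (C *m R)) *m A' = A *m (C *m R) *m A' by rewrite -!De eme.
  by rewrite !mulmxA AC mul1mx -!mulmxA RA' mulmx1.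
by rewrite {1}De mxtrace_mulC RC mxtrace1.
Qed.

(** The list resolves the identity into matrices with image in eigenspaces of [h]. The product of $X
    - a$ over the distinct eigenvalues kills [h], so its minimal polynomial has simple roots. *)
Lemma diagonalizable_roots h (e : seq ('M[K]_N * K)) :
  \sum_(p <- e) p.1 = 1 -> (forall p, p \in e -> h * p.1 = p.2 *: p.1) ->
  diagonalizable h.
Proof.
case: N h e => [|m] h e e1 eh.
  by rewrite [h]flatmx0; exact: diagonalizable0.
apply/diagonalizableP; exists (undup [seq p.2 | p <- e]); first exact: undup_uniq.
apply: mxminpoly_min; set P := \prod_(_ <- _) _.
rewrite -[LHS]mulr1 -e1 mulr_sumr big_seq big1 // => p pe.
have hP (Q : {poly K}) : horner_mx h Q * p.1 = Q.[p.2] *: p.1.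
  elim/poly_ind: Q => [|Q c IHQ]; first by rewrite rmorph0 mul0r horner0 scale0r.
  rewrite rmorphD rmorphM /= horner_mx_X horner_mx_C !hornerE.
  rewrite mulrDl -mulrA eh // -scalerAr IHQ scalerA [_ * p.1]mul_scalar_mx -scalerDl.
  by rewrite mulrC.
rewrite hP; suff /eqP-> : P.[p.2] == 0 by rewrite scale0r.
by rewrite -/(root P _) root_prod_XsubC mem_undup map_f.
Qed.

Lemma diagonalizable_nilp h k : diagonalizable h -> h ^+ k = 0 -> h = 0.
Proof.
move=> [P Pu /similar_diagPex [d /(similarP Pu) Ph]] hk.
suff Ph0 : P *m h = 0 by rewrite -[h](mulKmx Pu) Ph0 mulmx0.
have rowPh i : row i P *m h = d 0 i *: row i P.
  by rewrite -row_mul Ph row_mul row_diag_mx -scalemxAl -rowE.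
apply/row_matrixP => i; rewrite row_mul rowPh row0.
have [->|v0] := eqVneq (row i P) 0; first by rewrite scaler0.
by rewrite (eigen_nilp hk (rowPh i) v0) scale0r.
Qed.
Lemma natr_inj : [pchar K] =i pred0 -> injective (fun m => m%:R : K).
Proof.
move=> /pcharf0P charK i j; wlog le_ij : i j / (i <= j)%N => [W eq_ij | /eqP].
  by case/orP: (leq_total i j) => /W // W'; [exact: W' | exact/esym/W'].
rewrite eq_sym -subr_eq0 -natrB // charK subn_eq0 => le_ji.
by apply/eqP; rewrite eqn_leq le_ij.
Qed.

Lemma idem_trace0 e : [pchar K] =i pred0 -> e * e = e -> \tr e = 0 -> e = 0.
Proof.
move=> /pcharf0P charK /idem_trace -> /eqP.
by rewrite charK mxrank_eq0 => /eqP.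
Qed.

(** The polynomials $X^i$ and $(X+c)^k$ are coprime. Induction on [i]: once $T^{i+1}y = 0$,
    [T + c *: e] multiplies $T^i y$ by $c \neq 0$, so a power of it kills $T^i y$ only if $T^i y =
    0$. *)
Lemma coprime_nilp T e y (c : K) i k : c != 0 -> T * e = e * T -> e * y = y ->
  T ^+ i * y = 0 -> (T + c *: e) ^+ k * y = 0 -> y = 0.
Proof.
move=> c0 Te; elim: i y => [|i IHi] y ey Ty By; first by rewrite -Ty expr0 mul1r.
pose B := T + c *: e; rewrite -/B in By.
have TB : GRing.comm T B.
  rewrite /GRing.comm /B mulrDl mulrDr; congr (_ + _).
  by rewrite -[LHS]scalemxAr -[RHS]scalemxAl; congr (_ *: _).
have eT j : e * (T ^+ j * y) = T ^+ j * y.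
  by rewrite mulrA (commrX j (esym Te : GRing.comm e T)) -mulrA ey.
have Tz : T * (T ^+ i * y) = 0 by rewrite mulrA -exprS.
have Bz : B * (T ^+ i * y) = c *: (T ^+ i * y).
  by rewrite mulrDl Tz add0r -[LHS]scalemxAl; congr (_ *: _); exact: eT.
have Bkz m : B ^+ m * (T ^+ i * y) = c ^+ m *: (T ^+ i * y).
  elim: m => [|m IHm]; first by rewrite !expr0 scale1r mul1r.
  rewrite exprSr -mulrA Bz -[LHS]scalemxAr -[B ^+ m *m _]/(B ^+ m * _) IHm scalerA.
  by rewrite -exprS.
apply: IHi => //; apply/eqP; move/eqP: (Bkz k).
rewrite mulrA (commrX i (commr_sym (commrX k TB))) -mulrA By mulr0 eq_sym scaler_eq0.
by rewrite expf_eq0 (negPf c0) andbF.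
Qed.

End Matrices.

(** * Idempotents of the even centralizer *)

Section Centralizer.
Variables (K : closedFieldType) (N : nat) (x s : 'M[K]_N).
Implicit Types T e f h : 'M[K]_N.

(** This is the algebra $C$: later [s] is the parity operator, and commuting with it means being
    even. *)
Definition even_cent T := x * T = T * x /\ s * T = T * s.

Lemma mxscaleAl (a : K) T h : a *: T * h = a *: (T * h).
Proof. exact: esym (scalemxAl a T h). Qed.

Lemma mxscaleAr (a : K) T h : T * (a *: h) = a *: (T * h).
Proof. exact: esym (scalemxAr a T h). Qed.

Lemma even_cent0 : even_cent 0.
Proof. by split; rewrite mulr0 mul0r. Qed.

Lemma even_cent1 : even_cent 1.
Proof. by split; rewrite mulr1 mul1r. Qed.

Lemma even_centD T h : even_cent T -> even_cent h -> even_cent (T + h).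
Proof. by move=> [xT sT] [xh sh]; split; rewrite mulrDl mulrDr ?xT ?xh ?sT ?sh. Qed.

Lemma even_centZ a T : even_cent T -> even_cent (a *: T).
Proof. by move=> [xT sT]; split; rewrite mxscaleAl mxscaleAr ?xT ?sT. Qed.

Lemma even_centN T : even_cent T -> even_cent (- T).
Proof. by move=> cT; rewrite -scaleN1r; exact: even_centZ. Qed.

Lemma even_centB T h : even_cent T -> even_cent h -> even_cent (T - h).
Proof. by move=> cT ch; apply/even_centD/even_centN. Qed.

Lemma even_centM T h : even_cent T -> even_cent h -> even_cent (T * h).
Proof.
by move=> [xT sT] [xh sh]; split; rewrite mulrA ?xT ?sT -!mulrA ?xh ?sh.
Qed.

Lemma even_cent_comm T h :
  (forall Y, Y * T = T * Y -> Y * h = h * Y) -> even_cent T -> even_cent h.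
Proof. by move=> Th [xT sT]; split; exact: Th. Qed.

(** Membership in the corner ring $eCe$. *)
Definition corner e T := [/\ even_cent T, e * T = T & T * e = T].

Lemma cornerB e T h : corner e T -> corner e h -> corner e (T - h).
Proof.
move=> [cT eT Te] [ch eh he]; split; first exact: even_centB.
  by rewrite mulrBr eT eh.
by rewrite mulrBl Te he.
Qed.

Lemma cornerD e T h : corner e T -> corner e h -> corner e (T + h).
Proof.
move=> [cT eT Te] [ch eh he]; split; first exact: even_centD.
  by rewrite mulrDr eT eh.
by rewrite mulrDl Te he.
Qed.

Lemma cornerZ a e T : corner e T -> corner e (a *: T).
Proof.
move=> [cT eT Te]; split; first exact: even_centZ.
  by rewrite mxscaleAr eT.
by rewrite mxscaleAl Te.
Qed.

Lemma cornerM e T h : corner e T -> corner e h -> corner e (T * h).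
Proof.
move=> [cT eT Te] [ch eh he]; split; first exact: even_centM.
  by rewrite mulrA eT.
by rewrite -mulrA he.
Qed.

Lemma corner_compress e T :
  even_cent e -> e * e = e -> even_cent T -> corner e (e * T * e).
Proof.
move=> ce ee cT; split; first by do 2?apply: even_centM.
  by rewrite !mulrA ee.
by rewrite -!mulrA ee.
Qed.

Lemma corner_id e : even_cent e -> e * e = e -> corner e e.
Proof. by []. Qed.

(** The Fitting idempotent and partial inverse of [T] commute with [e]; multiplying them by [e]
    brings them into $eCe$. *)
Lemma corner_fitting e T : even_cent e -> e * e = e -> corner e T ->
  exists f R k, [/\ corner e f /\ f * f = f, corner e R, T ^+ k * f = 0,
    R * T = e - f /\ T * R = e - f
    & forall Y, Y * T = T * Y -> Y * e = e * Y -> Y * f = f * Y /\ Y * R = R * Y].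
Proof.
move=> ce ee [cT eT Te]; have [f [S [k [ff Tf ST com]]]] := fitting T.
have [ef eS] : e * f = f * e /\ e * S = S * e by apply: com; rewrite eT Te.
have [_ TS] : T * f = f * T /\ T * S = S * T by exact: com.
have cf : even_cent f by apply: even_cent_comm cT => Y /com [].
have cS : even_cent S by apply: even_cent_comm cT => Y /com [].
have fe : 1 - f = e - e * f.
  by rewrite -{1}[e]mulr1 -mulrBr -ST mulrA eS -mulrA eT.
have efefef : e * f * (e * f) = e * f by rewrite {2}ef mulrA -(mulrA e) ff -mulrA -ef mulrA ee.
exists (e * f), (S * e), k; split.
- split=> //; split; first exact: even_centM.
    by rewrite mulrA ee.
  by rewrite {1}ef -mulrA ee.
- split; first exact: even_centM.
    by rewrite -eS mulrA ee.
  by rewrite -mulrA ee.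
- by rewrite ef mulrA Tf mul0r.
- split; first by rewrite -mulrA eT ST fe.
  by rewrite mulrA TS -mulrA Te ST fe.
- move=> Y /com [Yf YS] Ye; split; first by rewrite mulrA Ye -mulrA Yf mulrA.
  by rewrite mulrA YS -!mulrA Ye.
Qed.

(** The ring $eCe$ is local, with nilpotent non-units. The zero idempotent is allowed, which covers
    an absent summand. *)
Definition local_idem e := [/\ even_cent e, e * e = e
  & forall T, corner e T -> (exists k, T ^+ k = 0) \/
      exists R, [/\ corner e R, R * T = e & T * R = e]].

Definition primitive e := [/\ e != 0, even_cent e, e * e = e
  & forall f, corner e f -> f * f = f -> f = 0 \/ f = e].

(** Equivalence of idempotents: [b] and [a] restrict to mutually inverse isomorphisms between the
    images of [e] and [f]. *)
Definition mx_equiv e f := exists a b,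
  [/\ even_cent a /\ even_cent b, e * a = a /\ a * f = a, f * b = b /\ b * e = b,
      a * b = e & b * a = f].

Lemma local0 : local_idem 0.
Proof.
split=> [||T [_ <- _]]; [exact: even_cent0 | exact: mul0r |].
by left; exists 1%N; rewrite mul0r expr1.
Qed.

(** The Fitting idempotent of [T] in $eCe$ is 0 or [e]; accordingly [T] is invertible or
    nilpotent. *)
Lemma primitive_local e : primitive e -> local_idem e.
Proof.
move=> [e0 ce ee prim]; split=> // T cT.
have [f [R [k [[cf ff] cR Tf [RT TR] _]]]] := corner_fitting ce ee cT.
case: (prim f cf ff) => Df; last first.
  left; exists k.+1; case: cT => _ eT _.
  by rewrite exprSr -{2}eT mulrA -Df Tf mul0r.
by right; exists R; rewrite RT TR Df subr0.
Qed.

(** Inside $eCe$, $TR = e$ implies $T^m R^m = e$ for all $m$. *)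
Lemma corner_rinv_nilp e T R k :
  corner e T -> corner e R -> T * R = e -> T ^+ k = 0 -> e = 0.
Proof.
move=> [_ eT Te] [_ eR Re] TR Tk.
suff TRk m : e * T ^+ m * R ^+ m * e = e * e.
  have ee : e * e = e by rewrite -{2}TR mulrA eT.
  by rewrite -ee -(TRk k) Tk mulr0 !mul0r.
elim: m => [|m IHm]; first by rewrite !expr0 !mulr1.
rewrite exprSr exprS !mulrA -(mulrA _ T R) TR.
rewrite -IHm; case: m {IHm} => [|m]; last by rewrite exprSr !mulrA -[in LHS](mulrA _ T e) Te.
have ee : e * e = e by rewrite -{2}TR mulrA eT.
by rewrite !expr0 !mulr1 ee.
Qed.

(** If $Th$ were a unit, the nilpotent [T] would have a right inverse, forcing $e = 0$. *)
Lemma local_nilpM e T h k : local_idem e -> corner e T -> corner e h ->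
  T ^+ k = 0 -> exists m, (T * h) ^+ m = 0.
Proof.
move=> [ce ee loc] cT ch Tk.
have [//|[R [cR _ ThR]]] := loc _ (cornerM cT ch).
have e0 : e = 0 by apply: corner_rinv_nilp cT (cornerM ch cR) _ Tk; rewrite mulrA.
by exists 1%N; case: cT => _ <- _; rewrite e0 !mul0r expr1.
Qed.

(** The residue field is the algebraically closed [K]: for an eigenvalue [a] of a unit [T] on the
    image of [e], [T - a *: e] is not a unit, hence nilpotent. *)
Lemma local_eigen e T : local_idem e -> corner e T ->
  exists a k, (T - a *: e) ^+ k = 0.
Proof.
move=> [ce ee loc] cT; have [[k Tk]|nT] := loc T cT.
  by exists 0, k; rewrite scale0r subr0.
case: nT => R [cR RT TR]; have [e0|e0] := eqVneq e 0.
  by exists 0, 1%N; case: cT => _ <- _; rewrite e0 mul0r scaler0 subr0 expr1.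
have [[k Tk]|[a [v [va v0 a0]]]] := nilp_or_eigen T.
  by case/eqP: e0; apply: corner_rinv_nilp cT cR TR Tk.
have ve : v *m e = v.
  apply: (scalerI a0); rewrite scalemxAl -va -mulmxA; congr (v *m _).
  by case: cT.
have cTa : corner e (T - a *: e) by apply/cornerB/cornerZ.
exists a; have [//|[Q [_ _ TQ]]] := loc _ cTa; case/eqP: v0.
by rewrite -ve -TQ mulmxA mulmxBr -scalemxAr va ve subrr mul0mx.
Qed.

(** Were the product a unit of $eCe$ with inverse [R], then $a = eTf$ and $b = fheR$ would satisfy
    $ab = e$, and $ba$ would be a nonzero idempotent of $fCf$, hence [f]: an equivalence. *)
Lemma primitive_nonequiv e f T h : primitive e -> primitive f -> ~ mx_equiv e f ->
  even_cent T -> even_cent h -> exists k, (e * T * f * h * e) ^+ k = 0.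
Proof.
move=> pe pf neq cT ch; have [_ _ loc] := primitive_local pe.
case: pe pf => e0 ce ee _ [f0 cf ff prim].
have cTh : corner e (e * T * f * h * e).
  have := corner_compress ce ee (even_centM (even_centM cT cf) ch).
  by rewrite !mulrA.
have [//|[R [[cR eR Re] RT TR]]] := loc _ cTh; case: neq.
pose a := e * T * f; pose b := f * h * e * R.
have ab : a * b = e by rewrite /a /b !mulrA -[_ * f * f]mulrA ff.
have ea : e * a = a by rewrite /a !mulrA ee.
have af : a * f = a by rewrite /a -!mulrA ff.
have fb : f * b = b by rewrite /b !mulrA ff.
have be : b * e = b by rewrite /b -!mulrA Re.
have ca : even_cent a by do ?apply: even_centM.
have cb : even_cent b by do ?apply: even_centM.
exists a, b; split=> //; case: (prim (b * a)) => //.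
- split; [exact: even_centM | by rewrite mulrA fb | by rewrite -mulrA af].
- by rewrite mulrA -(mulrA b a b) ab be.
- move=> ba0; case/eqP: e0; have -> : e = a * b * a * b by rewrite ab ea ab.
  by rewrite -(mulrA a b a) ba0 mulr0 mul0r.
Qed.

(** Each $E_i h E_j S E_i$ is nilpotent, so $\operatorname{tr}(hS) = 0$ for every $S$ in $C$. For
    the Fitting inverse $S$ of [h], the idempotent $Sh$ then has trace 0, so it vanishes in
    characteristic 0 and [h] is nilpotent. *)
Lemma cent_nilp (I : finType) (E : I -> 'M[K]_N) h :
    [pchar K] =i pred0 -> even_cent h ->
    (forall i, local_idem (E i)) -> \sum_i E i = 1 ->
    (forall i j T S, i != j -> even_cent T -> even_cent S ->
       exists k, (E i * T * E j * S * E i) ^+ k = 0) ->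
    (forall i, exists k, (E i * h * E i) ^+ k = 0) ->
  exists k, h ^+ k = 0.
Proof.
move=> charK ch locE sumE offE diagE.
have trh S : even_cent S -> \tr (h * S) = 0.
  move=> cS; have hS : h * S = \sum_j h * E j * S.
    by rewrite -mulr_suml -mulr_sumr sumE mulr1.
  have -> : h * S = \sum_i \sum_j E i * (h * E j * S).
    by under eq_bigr do rewrite -mulr_sumr -hS; rewrite -mulr_suml sumE mul1r.
  rewrite raddf_sum big1 //= => i _; rewrite raddf_sum big1 //= => j _.
  have [cEi EEi _] := locE i; have [cEj EEj _] := locE j.
  have -> : \tr (E i * (h * E j * S)) = \tr (E i * h * E j * S * E i).
    by rewrite -{1}EEi -mulrA [LHS]mxtrace_mulC -[_ *m _]/(_ * _) !mulrA.
  suff [k /nilp_trace] : exists k, (E i * h * E j * S * E i) ^+ k = 0 by [].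
  (* For [i = j], $E_i h E_i$ is nilpotent in a local ring, so its product with $E_i S E_i$ stays
     nilpotent. *)
  have [<-|] := eqVneq i j; last by move=> nij; exact: offE.
  have [k hk] := diagE i.
  have := local_nilpM (locE i) (corner_compress cEi EEi ch)
    (corner_compress cEi EEi cS) hk.
  by rewrite !mulrA -[_ * E i * E i]mulrA EEi.
have [e [S [k [ee hke Sh com]]]] := fitting h.
have cS : even_cent S by apply: even_cent_comm ch => Y /com [].
have e1 : (1 - e) * (1 - e) = 1 - e.
  by rewrite mulrBl mul1r mulrBr mulr1 ee subrr subr0.
have tr0 : \tr (1 - e) = 0 by rewrite -Sh [LHS]mxtrace_mulC; exact: trh.
move: tr0; rewrite (idem_trace e1) => /eqP.
have /pcharf0P -> := charK; rewrite mxrank_eq0 subr_eq0 => /eqP e_1.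
by exists k; rewrite -[LHS]mulr1 e_1.
Qed.

End Centralizer.

(** * Rank and supertrace of even idempotents *)

Section Superdimension.
Variables (K : closedFieldType) (N : nat) (x s : 'M[K]_N).
Hypothesis charK : [pchar K] =i pred0.
Hypothesis ss : s * s = 1.
Implicit Types T e f h : 'M[K]_N.

Lemma two_neq0 : 2 != 0 :> K.
Proof. by move/pcharf0P: charK => ->. Qed.

Lemma even_cent_nilp_str T k : even_cent x s T -> T ^+ k = 0 -> \tr (s * T) = 0.
Proof.
move=> [_ sT] Tk; apply: (@nilp_trace _ _ _ k).
by rewrite (exprMn_comm _ (sT : GRing.comm s T)) Tk mulr0.
Qed.

(** The idempotent $\frac{1+s}{2}e$ projects onto the even part of the image of [e]; its rank is
    [a]. *)
Lemma idem_sdim e : even_cent x s e -> e * e = e ->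
  exists a : nat, \tr (s * e) + (\rank e)%:R = (a.*2)%:R.
Proof.
move=> [_ se] ee; pose e1 := 2^-1 *: ((1 + s) * e).
have e1e1 : e1 * e1 = e1.
  rewrite /e1 mxscaleAl mxscaleAr scalerA.
  have -> : (1 + s) * e * ((1 + s) * e) = 2 *: ((1 + s) * e).
    rewrite -mulrA (mulrA e) (_ : e * (1 + s) = (1 + s) * e); last first.
      by rewrite mulrDl mulrDr mulr1 mul1r se.
    rewrite -mulrA ee mulrA scaler_nat mulr2n -mulrDl; congr (_ * _).
    by rewrite mulrDl mul1r mulrDr mulr1 ss [s + 1]addrC.
  by rewrite scalerA mulfVK ?two_neq0.
exists (\rank e1); rewrite -muln2 natrM -(idem_trace e1e1) mxtraceZ mulrC.
by rewrite mulVKf ?two_neq0 // mulrDl mul1r raddfD /= (idem_trace ee) addrC.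
Qed.

Lemma mx_equiv_rank e f : e * e = e -> f * f = f -> mx_equiv x s e f ->
  \rank e = \rank f /\ \tr (s * e) = \tr (s * f).
Proof.
move=> ee ff [a [b [[[_ sa] cb] _ _ ab ba]]]; split.
  apply: (natr_inj charK); rewrite -(idem_trace ee) -(idem_trace ff) -ab -ba.
  exact: mxtrace_mulC.
by rewrite -ab -ba mulrA sa -mulrA [LHS]mxtrace_mulC -[_ *m _]/(_ * _) -mulrA.
Qed.

Lemma mx_equiv_sym e f : mx_equiv x s e f -> mx_equiv x s f e.
Proof. by move=> [a [b [[ca cb] ea fb ab ba]]]; exists b, a. Qed.

End Superdimension.

(** * Primitive idempotents of nonzero supertrace have odd rank *)

Section Jordan.
Variables (K : closedFieldType) (N : nat) (x s : 'M[K]_N) (d : 'rV[K]_N).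
Hypothesis charK : [pchar K] =i pred0.
Hypothesis sd : s = diag_mx d.
Hypothesis sx : s * x = - (x * s).

(** A matrix unit has rank one, so placing [M] between two copies only sees the entry $M_{ji}$, here
    normalized away. *)
Lemma delta_sandwich (M : 'M[K]_N) i j (E := (M j i)^-1 *: delta_mx i j) :
  M j i != 0 -> \tr (E * M) = 1 /\ E * M * E = E.
Proof.
move=> Mji; have DE : E = (M j i)^-1 *: (delta_mx i 0 *m delta_mx (0 : 'I_1) j).
  by rewrite mul_delta_mx.
have sand : delta_mx (0 : 'I_1) j *m M *m delta_mx i (0 : 'I_1) = (M j i)%:M.
  by rewrite -rowE -colE; apply/matrixP => a b; rewrite !mxE !ord1 eqxx.
split.
  rewrite DE mxscaleAl mxtraceZ -[_ * M]/(_ *m M) -mulmxA mxtrace_mulC sand.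
  by rewrite mxtrace_scalar mulr1n mulVf.
rewrite DE !mxscaleAl mxscaleAr; congr (_ *: _).
rewrite -[_ * _ * _]/(_ *m _ *m _) -!mulmxA (mulmxA _ M) (mulmxA (_ *m M)) sand.
by rewrite mul_scalar_mx -scalemxAr scalerA mulVf // scale1r.
Qed.

(* With [m] minimal such that [x ^+ m * e = 0] and a homogeneous matrix unit [E]
   such that [E x^(m-1) e E = E], the element [\sum_i e x^i E x^(m-1-i) e] of the
   local ring at [e] has trace [m], hence is invertible. *)
Lemma primitive_odd_rank k e : x ^+ k = 0 -> primitive x s e -> \tr (s * e) != 0 ->
  odd (\rank e).
Proof.
move=> xk pe; have [_ _ loc] := primitive_local pe.
case: pe => e0 [xe se] ee _ str_e.
have xie i : x ^+ i * e = e * x ^+ i.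
  by apply/esym/(commrX i (esym xe : GRing.comm e x)).
have xik i : s * x ^+ i = (-1) ^+ i *: (x ^+ i * s).
  elim: i => [|i IHi]; first by rewrite !expr0 mulr1 mul1r scale1r.
  rewrite [x ^+ _]exprS (mulrA s) sx -scaleN1r mxscaleAl -(mulrA x s) IHi.
  by rewrite mxscaleAr scalerA mulrA [in RHS]exprS.
have exm : exists m, x ^+ m * e == 0 by exists k; rewrite xk mul0r.
(* The nilpotency index of [x] on the image of [e] is written [m.+1]; it is positive as [e] is
   nonzero. *)
case: (ex_minnP exm) => -[|m] /eqP xm m_min.
  by case/eqP: e0; rewrite -xm expr0 mul1r.
pose M := x ^+ m * e.
have eM : e * M = M by rewrite mulrA -xie -mulrA ee.
have xM : x * M = 0 by rewrite mulrA -exprS.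
have [j [i Mji]] : exists j i, M j i != 0.
  have : M != 0 by apply/negP => /m_min; rewrite ltnn.
  by move/matrix0Pn.
have sM : s * M = (-1) ^+ m *: (M * s) by rewrite mulrA xik mxscaleAl -!mulrA se.
have [E [trEM EME sE]] : exists E : 'M[K]_N,
    [/\ \tr (E * M) = 1, E * M * E = E & s * E = (-1) ^+ m *: (E * s)].
  exists ((M j i)^-1 *: delta_mx i j).
  have [trEM EME] := delta_sandwich Mji; split=> {trEM EME}//.
  (* [M] has parity $m$, so its nonzero entry relates the signs of [s] at [j] and [i]; hence the
     matrix unit is homogeneous of parity $m$. *)
  have dj : d 0 j = (-1) ^+ m * d 0 i.
    apply: (mulIf Mji); have /matrixP/(_ j i) := sM.
    rewrite sd -[_ * M]/(_ *m M) -[M * _]/(M *m _) mul_diag_mx mul_mx_diag !mxE => ->.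
    by rewrite -mulrA [d 0 i * _]mulrC.
  have [sdE Esd] : s * delta_mx i j = d 0 i *: delta_mx i j
      /\ delta_mx i j * s = d 0 j *: delta_mx i j.
    rewrite sd -[_ * delta_mx i j]/(_ *m _) -[delta_mx i j * _]/(_ *m _).
    rewrite mul_diag_mx mul_mx_diag.
    split; apply/matrixP => a b; rewrite !mxE.
      by case: (a =P i) => [->//|_]; rewrite !mulr0.
    by rewrite mulrC; case: (b =P j) => [->//|_]; rewrite andbF !mulr0.
  rewrite mxscaleAr mxscaleAl sdE Esd !scalerA dj; congr (_ *: _).
  by rewrite [X in _ = _ * X]mulrCA (mulrA ((-1) ^+ m)) -expr2 sqrr_sign mul1r.
pose T := \sum_(r < m.+1) e * x ^+ r * E * x ^+ (m - r) * e.
have cT : corner x s e T.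
  split; last 2 first.
  - by rewrite mulr_sumr; apply: eq_bigr => r _; rewrite !mulrA ee.
  - by rewrite mulr_suml; apply: eq_bigr => r _; rewrite -!mulrA ee.
  split; rewrite mulr_sumr mulr_suml.
    (* $xT$ and $Tx$ are the same sum up to an index shift; the extreme terms vanish since $x^{m+1}e
       = 0$. *)
    rewrite big_ord_recr big_ord_recl /= subn0 subnn.
    have xex : x * (e * x ^+ m) = 0 by rewrite -xie mulrA -exprS.
    have xmex : x ^+ m * e * x = 0 by rewrite -mulrA -xe mulrA -exprSr.
    have -> : x * (e * x ^+ m * E * x ^+ 0 * e) = 0 by rewrite !mulrA -(mulrA x) xex !mul0r.
    have -> : e * x ^+ 0 * E * x ^+ m * e * x = 0.
      by rewrite -(mulrA _ e) -(mulrA _ (x ^+ m)) (mulrA (x ^+ m)) xmex mulr0.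
    rewrite add0r addr0; apply: eq_bigr => r _; rewrite /bump /= add1n.
    rewrite !mulrA xe -(mulrA e x) -exprS -[in RHS](mulrA _ e x) -xe mulrA.
    by rewrite -[in RHS](mulrA _ _ x) -exprSr subnSK.
  (* The parities $r$, $m$ and $m-r$ of the three factors have an even sum. *)
  apply: eq_bigr => r _; rewrite !mulrA se -(mulrA e s) xik mxscaleAr !mxscaleAl.
  rewrite mulrA -(mulrA _ s E) sE mxscaleAr !mxscaleAl scalerA mulrA.
  rewrite -(mulrA _ s (x ^+ _)) xik mxscaleAr mxscaleAl scalerA mulrA -[in LHS](mulrA _ s e) se.
  suff -> : (-1) ^+ r * (-1) ^+ m * (-1) ^+ (m - r) = 1 :> K by rewrite scale1r mulrA.
  by rewrite mulrAC -exprD (subnKC (leq_ord r)) -expr2 sqrr_sign.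
have cyc A B : \tr (A * E * B) = \tr (E * (B * A)).
  by rewrite -mulrA [LHS]mxtrace_mulC -[_ *m _]/(_ * _) -mulrA.
have trT : \tr T = m.+1%:R.
  rewrite raddf_sum (eq_bigr (fun=> 1)) /= => [|r _]; first by rewrite sumr_const card_ord.
  rewrite -(mulrA _ (x ^+ (m - r)) e) cyc -trEM; congr (\tr (_ * _)).
  by rewrite mulrA -(mulrA _ e e) ee -mulrA -xie mulrA -exprD (subnK (leq_ord r)).
have [[l Tl]|[R [[[xR sR] eR Re] RT TR]]] := loc _ cT.
  have := nilp_trace Tl; rewrite trT => /eqP.
  by have /pcharf0P -> := charK.
(* Since $xM = 0$, only the last term of [T] acts on [M * E], and it fixes it by $EME = E$; so the
   inverse [R] fixes it too. *)
have RME : R * (M * E) = M * E.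
  suff TME : T * (M * E) = M * E.
    by rewrite -{1}TME (mulrA R) RT (mulrA e) eM.
  rewrite /T mulr_suml big_ord_recr big1 /= => [|r _].
    rewrite add0r subnn expr0 mulr1 -(mulrA _ e) (mulrA e M) eM -xie.
    by rewrite -(mulrA _ E) (mulrA E) EME.
  suff -> : e * x ^+ r * E * x ^+ (m - r) * e * (M * E) =
            e * x ^+ r * E * (x ^+ (m - r).-1 * (x * M) * E).
    by rewrite xM mulr0 mul0r mulr0.
  rewrite (mulrA _ x) -exprSr prednK ?subn_gt0 // -!mulrA; congr (_ * (_ * (_ * (_ * _)))).
  by rewrite 2!mulrA -xie -(mulrA _ e e) ee -mulrA.
have xRi i' : R * x ^+ i' = x ^+ i' * R.
  exact: (commrX i' (esym xR : GRing.comm R x)).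
have trYT (Y : 'M[K]_N) (r : 'I_m.+1) :
    \tr (Y * (e * x ^+ r * E * x ^+ (m - r) * e) * R) =
    \tr (E * (x ^+ (m - r) * (R * (Y * (e * x ^+ r))))).
  rewrite -(mulrA Y) -(mulrA _ e R) eR -(mulrA _ _ R) (mulrA Y) (mulrA Y) cyc.
  by rewrite -!mulrA.
(* Expanding $e = TR$ termwise, each of the [m.+1] terms has trace $\operatorname{tr}(EM) = 1$: the
   image of [e] is a single Jordan block. *)
have tre : \tr e = m.+1%:R.
  rewrite -{1}TR -[T]mul1r mulr_sumr mulr_suml raddf_sum (eq_bigr (fun=> 1)) /= => [|r _].
    by rewrite sumr_const card_ord.
  rewrite trYT mul1r -xie (mulrA R) xRi -(mulrA (x ^+ r)) (mulrA (x ^+ (m - r))).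
  rewrite -exprD (subnK (leq_ord r)) (mulrA (x ^+ m)) -xRi -(mulrA R).
  by rewrite [LHS]mxtrace_mulC -[_ *m _]/(_ * _) -(mulrA R) RME [LHS]mxtrace_mulC.
have rkE : \rank e = m.+1 by apply: (natr_inj charK); rewrite -idem_trace.
have alt n : \sum_(r < n) (-1) ^+ r = (odd n)%:R :> K.
  elim: n => [|n IHn]; first by rewrite big_ord0.
  rewrite big_ord_recr /= IHn -signr_odd.
  by case: (odd n); rewrite ?expr1 ?expr0 ?subrr ?add0r.
rewrite rkE; apply: contraNT str_e => m_even; apply/eqP.
(* Up to the signs $(-1)^r$ all terms of the same expansion of $se$ have equal trace, so they cancel
   when the rank is even. *)
have -> : \tr (s * e) = \sum_(r < m.+1) (-1) ^+ r * \tr (E * (x ^+ m * (R * (s * e)))).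
  rewrite -{1}TR mulrA mulr_sumr mulr_suml raddf_sum /=; apply: eq_bigr => r _.
  rewrite trYT -xie (mulrA s) xik mxscaleAl !mxscaleAr mxtraceZ; congr (_ * \tr (_ * _)).
  by rewrite -(mulrA _ s) (mulrA R) xRi -mulrA mulrA -exprD (subnK (leq_ord r)).
by rewrite -mulr_suml alt (negPf m_even) mul0r.
Qed.

End Jordan.

(** * The adjunction and hyperbolic idempotents *)

Section Involution.
Variables (K : closedFieldType) (N : nat) (x s J : 'M[K]_N).
Hypothesis charK : [pchar K] =i pred0.
Hypothesis ss : s * s = 1.
Hypothesis Jsym : J^T = J.
Hypothesis Junit : J \in unitmx.
Implicit Types T e f g h : 'M[K]_N.

(** The adjoint for the bilinear form with Gram matrix [J]: $(Tv)^T J w = v^T J (J^{-1}T^T J) w$. *)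
Definition adjoint T := invmx J *m T^T *m J.

(** These two conditions express that [x] is odd and preserves the form, and that the form is
    odd. *)
Hypothesis adj_x : adjoint x = s * x.
Hypothesis adj_s : adjoint s = - s.

Local Notation even_cent := (even_cent x s).
Local Notation corner := (corner x s).
Local Notation primitive := (primitive x s).
Local Notation local_idem := (local_idem x s).
Local Notation mx_equiv := (mx_equiv x s).

Lemma adjointM T h : adjoint (T * h) = adjoint h * adjoint T.
Proof.
rewrite /adjoint -[_ * _ in LHS]/(_ *m _) -[RHS]/(_ *m _) trmx_mul.
by rewrite !mulmxA mulmxK.
Qed.

Lemma adjointD T h : adjoint (T + h) = adjoint T + adjoint h.
Proof. by rewrite /adjoint linearD mulmxDr mulmxDl. Qed.

Lemma adjointZ a T : adjoint (a *: T) = a *: adjoint T.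
Proof. by rewrite /adjoint linearZ -scalemxAr -scalemxAl. Qed.

Lemma adjointN T : adjoint (- T) = - adjoint T.
Proof. by rewrite -scaleN1r adjointZ scaleN1r. Qed.

Lemma adjointB T h : adjoint (T - h) = adjoint T - adjoint h.
Proof. by rewrite adjointD adjointN. Qed.

Lemma adjoint1 : adjoint 1 = 1.
Proof. by rewrite /adjoint trmx1 mulmx1 mulVmx. Qed.

Lemma adjoint0 : adjoint 0 = 0.
Proof. by rewrite /adjoint trmx0 mulmx0 mul0mx. Qed.

Lemma adjointK T : adjoint (adjoint T) = T.
Proof.
rewrite /adjoint !trmx_mul trmxK trmx_inv Jsym !mulmxA.
by rewrite mulVmx // mul1mx -mulmxA mulVmx // mulmx1.
Qed.

Lemma adjointX T k : adjoint (T ^+ k) = adjoint T ^+ k.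
Proof.
elim: k => [|k IHk]; first by rewrite !expr0 adjoint1.
by rewrite exprS exprSr adjointM IHk.
Qed.

Lemma mxtrace_adjoint T : \tr (adjoint T) = \tr T.
Proof. by rewrite mxtrace_mulC mulmxA mulmxV // mul1mx mxtrace_tr. Qed.

Lemma adjoint_even_cent T : even_cent T -> even_cent (adjoint T).
Proof.
move=> [xT sT].
have sA : s * adjoint T = adjoint T * s.
  by apply: oppr_inj; rewrite -mulNr -mulrN -adj_s -!adjointM sT.
have Dx : x = s * adjoint x by rewrite adj_x mulrA ss mul1r.
by split=> //; rewrite {1}Dx -mulrA -adjointM -xT adjointM mulrA sA -mulrA -Dx.
Qed.

Lemma adjoint_corner e T : adjoint e = e -> corner e T -> corner e (adjoint T).
Proof.
move=> ae [cT eT Te]; split; first exact: adjoint_even_cent.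
  by rewrite -{1}ae -adjointM Te.
by rewrite -{1}ae -adjointM eT.
Qed.

Lemma str_adjoint T : \tr (s * adjoint T) = - \tr (s * T).
Proof.
rewrite -mxtrace_adjoint adjointM adjointK adj_s mulrN raddfN /=.
by rewrite [in LHS]mxtrace_mulC.
Qed.

(** The images of [e] and $e^\ast$ are isotropic and independent, and [e + adjoint e] is a
    self-adjoint idempotent. *)
Definition hyperbolic e :=
  [/\ even_cent e, e * e = e, e * adjoint e = 0 & adjoint e * e = 0].

(** If [h] has an eigenvalue $a \neq 0$, let $f$ project onto its generalized eigenspace. By
    skewness $f^\ast$ belongs to the eigenvalue $-a \neq a$, so $f f^\ast = f^\ast f = 0$. *)
Lemma skew_hyperbolic g h : even_cent g -> g * g = g -> adjoint g = g ->
    corner g h -> adjoint h = - h ->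
  (exists k, h ^+ k = 0) \/ exists e, [/\ hyperbolic e, corner g e & e != 0].
Proof.
move=> cg gg ag gh ah; have [hk|[a [v [va v0 a0]]]] := nilp_or_eigen h; first by left.
right; have [ch gh_ hg_] := gh.
have vg : v *m g = v.
  by apply: (scalerI a0); rewrite scalemxAl -va -mulmxA; congr (v *m _).
pose T := h - a *: g; have cT : corner g T by apply/cornerB/cornerZ.
have [f [R [k [[gf ff] _ Tf [RT TR] com]]]] := corner_fitting cg gg cT.
have [cf gf_ fg_] := gf.
have hT : h * T = T * h.
  by rewrite mulrBl mulrBr mxscaleAl mxscaleAr gh_ hg_.
have gT : g * T = T * g by case: cT => _ -> ->.
have [hf _] : h * f = f * h /\ h * R = R * h by apply: com; rewrite // gh_ hg_.
have haf : h * adjoint f = adjoint f * h.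
  by apply: oppr_inj; rewrite -mulNr -mulrN -ah -!adjointM hf.
have gaf : g * adjoint f = adjoint f by rewrite -{1}ag -adjointM fg_.
have afg : adjoint f * g = adjoint f by rewrite -{1}ag -adjointM gf_.
have a2 : a + a != 0 by rewrite -mulr2n -mulr_natr mulf_neq0 ?(two_neq0 charK).
have aT : adjoint T = - (T + (a + a) *: g).
  rewrite adjointB adjointZ ah ag scalerDl /T addrA subrK opprD.
  by [].
(* Both products to be shown zero are killed by $T^k$ and by $(T + 2ag)^k$. *)
have faf0 y : g * y = y -> T ^+ k * y = 0 -> (T + (a + a) *: g) ^+ k * y = 0 -> y = 0.
  by apply: coprime_nilp.
pose B := T + (a + a) *: g; rewrite -/B in aT faf0.
have afB : GRing.comm (adjoint f) B.
  rewrite /GRing.comm mulrDr mulrDl mulrBr mulrBl !mxscaleAl !mxscaleAr haf gaf afg.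
  by [].
have Baf : B ^+ k * adjoint f = 0.
  have : adjoint f * (- B) ^+ k = 0.
    by rewrite -aT -adjointX -adjointM Tf adjoint0.
  rewrite -(commrX k afB) exprNn -signr_odd; case: (odd k); last by rewrite expr0 mul1r.
  by rewrite expr1 mulN1r mulrN => /eqP; rewrite oppr_eq0 => /eqP.
have fB : GRing.comm f B.
  rewrite /GRing.comm mulrDr mulrDl mulrBr mulrBl !mxscaleAl !mxscaleAr hf gf_ fg_.
  by [].
have afT : GRing.comm (adjoint f) T.
  by rewrite /GRing.comm mulrBr mulrBl !mxscaleAl !mxscaleAr haf gaf afg.
exists f; split=> //.
- split=> //; apply: faf0.
  + by rewrite mulrA gf_.
  + by rewrite mulrA Tf mul0r.
  + by rewrite mulrA -(commrX k fB) -mulrA Baf mulr0.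
  + by rewrite mulrA gaf.
  + by rewrite mulrA -(commrX k afT) -mulrA Tf mulr0.
  + by rewrite mulrA Baf mul0r.
(* If $f = 0$, then [T] is invertible in the corner, which contradicts $vT = 0$ for the eigenvector
   [v]. *)
- apply: contraNneq v0 => f0; rewrite -vg -[g]subr0 -f0 -TR mulmxA mulmxBr va.
  by rewrite -scalemxAr vg subrr mul0mx.
Qed.

Definition sa_indec e := [/\ e != 0, even_cent e, e * e = e, adjoint e = e
  & forall f, corner e f -> f * f = f -> adjoint f = f -> f = 0 \/ f = e].

(** The Fitting idempotent [f] of a self-adjoint [T] is self-adjoint, hence 0 or [e]: $T^k f^\ast =
    0$ while [T] is invertible on the image of $e - f$, so $f^\ast = f f^\ast$, and the right side
    is self-adjoint. *)
Lemma sa_indec_sym e T : sa_indec e -> corner e T -> adjoint T = T ->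
  (exists k, T ^+ k = 0) \/ exists R, [/\ corner e R, R * T = e & T * R = e].
Proof.
move=> [e0 ce ee ae prim] cT aT.
have [f [R [k [[cf ff] cR Tf [RT TR] com]]]] := corner_fitting ce ee cT.
have [[_ ef fe] [_ eT Te]] := (cf, cT).
have [fT TR'] : T * f = f * T /\ T * R = R * T by apply: com; rewrite // eT Te.
have [_ eaf afe] := adjoint_corner ae cf.
have efT : (e - f) * T = T * (e - f) by rewrite mulrBl mulrBr eT Te fT.
have efe : (e - f) * (e - f) = e - f.
  by rewrite mulrBl !mulrBr ee ef fe ff subrr subr0.
have efk m : e - f = (e - f) * (R ^+ m * T ^+ m).
  elim: m => [|m IHm]; first by rewrite !expr0 !mulr1.
  rewrite exprSr exprS !mulrA -(mulrA _ R T) RT -mulrA.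
  rewrite (commrX m (efT : GRing.comm (e - f) T)) mulrA -[in RHS](mulrA (e - f)) -IHm.
  by rewrite efe.
have af : adjoint f = f * adjoint f.
  apply/eqP; rewrite -subr_eq0 -{1}eaf -mulrBl (efk k) -!mulrA.
  have -> : T ^+ k * adjoint f = adjoint f * T ^+ k.
    have afT : GRing.comm (adjoint f) T by rewrite /GRing.comm -{1}aT -adjointM fT adjointM aT.
    exact/esym/commrX.
  have -> : adjoint f * T ^+ k = 0 by rewrite -aT -adjointX -adjointM Tf adjoint0.
  by rewrite !mulr0.
have {}af : adjoint f = f by rewrite -{2}[f]adjointK {2}af adjointM adjointK -af.
case: (prim f cf ff af) => Df; last first.
  by left; exists k.+1; rewrite exprSr -[X in _ * X]eT mulrA -Df Tf mul0r.
by right; exists R; rewrite RT TR Df subr0.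
Qed.

(** Put $h = f - f^\ast$ and $S = f + f^\ast$, so that $h^2 = S(2e - S)$. For want of hyperbolic
    idempotents the skew [h] is nilpotent, so the self-adjoint $S$ and $2e - S$ are not both
    invertible; one is nilpotent, and its trace gives $f = 0$ or $f = e$. *)
Lemma sa_indec_primitive e : sa_indec e ->
  (forall f, hyperbolic f -> corner e f -> f = 0) -> primitive e.
Proof.
move=> sa nohyp; have [e0 ce ee ae _] := sa; split=> // f cf ff.
have caf := adjoint_corner ae cf.
pose F := adjoint f; pose S := f + F; pose h := f - F.
have [[_ ef fe] [_ eF Fe]] := (cf, caf).
have FF : F * F = F by rewrite -adjointM ff.
have cS : corner e S by exact: cornerD.
have cS' : corner e (2 *: e - S) by apply/cornerB/cS/cornerZ.
have aS : adjoint S = S by rewrite adjointD adjointK addrC.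
have aS' : adjoint (2 *: e - S) = 2 *: e - S by rewrite adjointB adjointZ ae aS.
have trF : \tr F = \tr f by exact: mxtrace_adjoint.
have hh : h * h = S * (2 *: e - S).
  have SS : S * S = S + (f * F + F * f).
    by rewrite mulrDl !mulrDr ff FF [F * f + F]addrC addrACA.
  rewrite [in RHS]mulrBr mxscaleAr SS scaler_nat mulr2n; case: (cS) => _ _ ->.
  rewrite opprD addrA addrK mulrBl !mulrBr ff FF opprB addrACA.
  by rewrite opprD.
have [k hk] : exists k, h ^+ k = 0.
  case: (skew_hyperbolic ce ee ae (cornerB cf caf)) => [|//|[f' [hf' cf' f'0]]].
    by rewrite adjointB adjointK opprB.
  by case/eqP: f'0; exact: nohyp.
case: (sa_indec_sym sa cS aS) => [[l Sl]|[R [cR RS SR]]].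
  left; apply: (idem_trace0 charK ff); have /eqP := nilp_trace Sl.
  by rewrite raddfD /= trF -mulr2n -mulr_natl mulf_eq0 (negPf (two_neq0 charK)) => /eqP.
case: (sa_indec_sym sa cS' aS') => [[l Sl]|[R' [cR' RS' SR']]].
  right; apply/esym/eqP; rewrite -subr_eq0; apply/eqP/(idem_trace0 charK).
    by rewrite mulrBl !mulrBr ee ef fe ff subrr subr0.
  have := nilp_trace Sl; rewrite raddfB /= mxtraceZ raddfD /= trF -mulr2n -(mulr_natl (\tr f)) -mulrBr.
  by move/eqP; rewrite mulf_eq0 (negPf (two_neq0 charK)) raddfB => /eqP.
case/eqP: e0; apply: (@corner_rinv_nilp _ _ x s e (h * h) (R' * R) k).
- by apply: cornerM; apply: cornerB.
- exact: cornerM.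
- by rewrite hh mulrA -(mulrA S) SR'; case: cS => _ _ ->.
- by rewrite -expr2 -exprM mulnC exprM hk expr0n.
Qed.

(** The skew element $a - a^\ast$ has the right inverse $b - b^\ast$ in the corner of $e + f$, so it
    is not nilpotent and yields a hyperbolic idempotent there. *)
Lemma equiv_hyperbolic e f : e * e = e -> f * f = f -> even_cent e -> even_cent f ->
    adjoint e = e -> adjoint f = f -> e * f = 0 -> f * e = 0 -> e != 0 ->
    mx_equiv e f ->
  exists u, [/\ hyperbolic u, corner (e + f) u & u != 0].
Proof.
move=> ee ff ce cf ae af ef fe e0 [a [b [[ca cb] [ea afa] [fb be] ab ba]]].
pose g := e + f; pose A := adjoint a; pose B := adjoint b.
have [Ae fA] : A * e = A /\ f * A = A.
  by rewrite -[in LHS]ae -{1}[f]af -!adjointM ea afa.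
have [Bf eB] : B * f = B /\ e * B = B.
  by rewrite -[in LHS]af -{1}[e]ae -!adjointM fb be.
have BA : B * A = e by rewrite -adjointM ab.
have AB : A * B = f by rewrite -adjointM ba.
have gg : g * g = g by rewrite mulrDl !mulrDr ee ff ef fe addr0 add0r.
have ag : adjoint g = g by rewrite adjointD ae af.
have cg : even_cent g by exact: even_centD.
have corn u : even_cent u -> e * u = u -> u * f = u -> corner g u.
  move=> cu eu uf; split=> //.
    by rewrite mulrDl eu -eu mulrA fe mul0r addr0.
  by rewrite mulrDr uf -uf -mulrA fe mulr0 add0r.
have corn' u : even_cent u -> f * u = u -> u * e = u -> corner g u.
  move=> cu eu uf; split=> //.
    by rewrite mulrDl eu -eu mulrA ef mul0r add0r.
  by rewrite mulrDr uf -uf -mulrA ef mulr0 addr0.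
have gh : corner g (a - A).
  by apply: cornerB; [exact: corn | apply: corn' => //; exact: adjoint_even_cent].
have gb : corner g (b - B).
  by apply: cornerB; [exact: corn' | apply: corn => //; exact: adjoint_even_cent].
case: (skew_hyperbolic cg gg ag gh) => [|[k hk]|//].
  by rewrite adjointB adjointK opprB.
have g0 : g = 0.
  apply: corner_rinv_nilp gh gb _ hk.
  rewrite mulrBl !mulrBr ab AB.
  have -> : a * B = 0 by rewrite -afa -eB mulrA -(mulrA a) fe mulr0 mul0r.
  have -> : A * b = 0 by rewrite -Ae -fb mulrA -(mulrA A) ef mulr0 mul0r.
  by rewrite subr0 sub0r opprK.
have eg : e * g = e by rewrite mulrDr ee ef addr0.
by case/eqP: e0; rewrite -eg g0 mulr0.
Qed.

(** * Orthogonal splittings into primitive idempotents *)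

Definition orthogonal_idem e f := (e * f == 0) && (f * e == 0).

(** Induction on the rank: a non-minimal [g] splits as $f + (g - f)$ with self-adjoint parts of
    smaller rank; minimal ones are primitive in the absence of hyperbolic idempotents. *)
Lemma sa_split g : even_cent g -> g * g = g -> adjoint g = g ->
    (forall f, hyperbolic f -> corner g f -> f = 0) ->
  exists l : seq 'M[K]_N, [/\ \sum_(e <- l) e = g, pairwise orthogonal_idem l
    & forall e, e \in l -> [/\ primitive e, adjoint e = e & corner g e]].
Proof.
have [r] := ubnP (\rank g); elim: r g => // r IHr g; rewrite ltnS => rk_g cg gg ag nohyp.
have [->|g0] := eqVneq g 0; first by exists [::]; rewrite big_nil.
have [sa|nsa] := classic (sa_indec g).
  exists [:: g]; split=> [|//|e]; first by rewrite big_seq1.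
  rewrite inE => /eqP ->; split=> //; first exact: sa_indec_primitive.
have [f [gf ff af f0 fg]] : exists f,
    [/\ corner g f, f * f = f, adjoint f = f, f <> 0 & f <> g].
  apply: NNPP => nf; apply: nsa; split=> // f gf ff af.
  apply: NNPP => f0g; apply: nf; exists f.
  by split=> // f0; apply: f0g; [left | right].
have [cf gf_ fg_] := gf.
have cf' : even_cent (g - f) by exact: even_centB.
have ff' : (g - f) * (g - f) = g - f.
  by rewrite mulrBl !mulrBr gg gf_ fg_ ff subrr subr0.
have af' : adjoint (g - f) = g - f by rewrite adjointB ag af.
have gf' : corner g (g - f) by exact: cornerB.
have corner_sub e h : corner g e -> corner e h -> corner g h.
  move=> [_ ge eg] [ch eh he]; split=> //.
    by rewrite -eh mulrA ge.
  by rewrite -he -mulrA eg.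
have rkD : (\rank f + \rank (g - f)%R = \rank g)%N.
  apply: (natr_inj charK); rewrite natrD -!idem_trace //.
  by rewrite -raddfD /= addrC subrK.
have rkf : (0 < \rank f)%N by rewrite lt0n mxrank_eq0; apply/eqP.
have rkf' : (0 < \rank (g - f)%R)%N.
  by rewrite lt0n mxrank_eq0 subr_eq0; apply/eqP => gf''; apply: fg.
have [||l1 [sum1 orth1 in1]] := IHr f _ cf ff af.
- by apply: leq_trans rk_g; rewrite -rkD -[X in (X < _)%N]addn0 ltn_add2l.
- by move=> e he fe; apply: nohyp; last exact: corner_sub fe.
have [||l2 [sum2 orth2 in2]] := IHr (g - f) _ cf' ff' af'.
- by apply: leq_trans rk_g; rewrite -rkD -[X in (X < _)%N]add0n ltn_add2r.
- by move=> e he fe; apply: nohyp; last exact: corner_sub fe.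
exists (l1 ++ l2); split.
- by rewrite big_cat /= sum1 sum2 addrC subrK.
- rewrite pairwise_cat orth1 orth2 !andbT; apply/allrelP => e1 e2 le1 le2.
  have [_ _ [_ fe1 e1f]] := in1 _ le1; have [_ _ [_ fe2 e2f]] := in2 _ le2.
  have e12 : e1 * e2 = 0.
    by rewrite -e1f -fe2 -mulrA (mulrA f) mulrBr fg_ ff subrr mul0r mulr0.
  have e21 : e2 * e1 = 0.
    by rewrite -e2f -fe1 -mulrA (mulrA (g - f)) mulrBl gf_ ff subrr mul0r mulr0.
  by rewrite /orthogonal_idem e12 e21 eqxx.
- move=> e; rewrite mem_cat => /orP [/in1|/in2] [pe ae ge]; split=> //.
    exact: corner_sub ge.
  exact: corner_sub ge.
Qed.

(** In matrix terms: 0 is the only semisimple even element of $\mathfrak{spe}(n)$ commuting with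
    [x]. *)
Definition no_torus := forall h, even_cent h -> adjoint h = - h -> \tr (s * h) = 0 ->
  diagonalizable h -> h = 0.

Lemma str_skew e : \tr (s * (e - adjoint e)) = 2 * \tr (s * e).
Proof. by rewrite mulrBr raddfB /= str_adjoint opprK mulr_natl mulr2n. Qed.

(** The skew element $e - e^\ast$ is diagonalizable, with eigenvalues among 1, $-1$ and 0, and has
    supertrace $2\operatorname{str} e$. *)
Lemma hyperbolic_str e : no_torus -> hyperbolic e -> \tr (s * e) = 0 -> e = 0.
Proof.
move=> D [ce ee eae aee] str0.
have h0 : e - adjoint e = 0.
  apply: D.
  - exact/even_centB/adjoint_even_cent.
  - by rewrite adjointB adjointK opprB.
  - by rewrite str_skew str0 mulr0.
  - apply: (@diagonalizable_roots _ _ _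
      [:: (e, 1); (adjoint e, -1); (1 - (e + adjoint e), 0)]).
      by rewrite !big_cons big_nil addr0 addrA addrC subrK.
    have aeae : adjoint e * adjoint e = adjoint e by rewrite -adjointM ee.
    move=> p; rewrite !inE => /or3P [] /eqP -> /=.
    + by rewrite mulrBl ee aee subr0 scale1r.
    + by rewrite mulrBl eae aeae sub0r scaleN1r.
    + rewrite mulrBr mulr1 mulrDr !mulrBl ee aee eae aeae subr0 sub0r.
      by rewrite subrr scale0r.
by rewrite -ee -[in X in _ * X](subrK (adjoint e) e) h0 add0r.
Qed.

(** Two nonzero orthogonal pairs would span a two-dimensional torus, on which the supertrace imposes
    one linear condition only. *)
Lemma hyperbolic_orthogonal e f : no_torus -> hyperbolic e -> hyperbolic f ->
  e * f = 0 -> f * e = 0 -> e * adjoint f = 0 -> adjoint f * e = 0 -> e = 0 \/ f = 0.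
Proof.
move=> D he hf ef fe eaf afe; have [ce ee eae aee] := he; have [cf ff faf aff] := hf.
have [f0|strf] := eqVneq (\tr (s * f)) 0; first by right; exact: hyperbolic_str.
(* These coefficients make the supertrace $2(a \operatorname{str} e + b \operatorname{str} f)$ of
   [h] vanish, with $a \neq 0$. *)
left; pose a := \tr (s * f); pose b := - \tr (s * e).
have aeae : adjoint e * adjoint e = adjoint e by rewrite -adjointM ee.
have afaf : adjoint f * adjoint f = adjoint f by rewrite -adjointM ff.
have aeaf : adjoint e * adjoint f = 0 by rewrite -adjointM fe adjoint0.
have afae : adjoint f * adjoint e = 0 by rewrite -adjointM ef adjoint0.
have aef : adjoint e * f = 0 by rewrite -[f]adjointK -adjointM afe adjoint0.
have fae : f * adjoint e = 0 by rewrite -[f]adjointK -adjointM eaf adjoint0.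
pose h := a *: (e - adjoint e) + b *: (f - adjoint f).
have he' : h * e = a *: e.
  by rewrite mulrDl !mxscaleAl !mulrBl ee aee fe afe subrr subr0 scaler0 addr0.
have hae : h * adjoint e = - a *: adjoint e.
  by rewrite mulrDl !mxscaleAl !mulrBl eae aeae fae afae subrr sub0r scaler0 addr0 scalerN -scaleNr.
have hf' : h * f = b *: f.
  by rewrite mulrDl !mxscaleAl !mulrBl ff aff ef aef subrr subr0 scaler0 add0r.
have haf : h * adjoint f = - b *: adjoint f.
  by rewrite mulrDl !mxscaleAl !mulrBl faf afaf eaf aeaf subrr sub0r scaler0 add0r scalerN -scaleNr.
have h0 : h = 0.
  apply: D.
  - by apply: even_centD; apply/even_centZ/even_centB => //; apply: adjoint_even_cent.
  - by rewrite adjointD !adjointZ !adjointB !adjointK opprD -!scalerN !opprB.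
  - rewrite mulrDr !mxscaleAr raddfD /= !mxtraceZ !str_skew /a /b.
    by rewrite mulNr mulrCA [X in _ - X]mulrCA (mulrC (\tr (s * e))) subrr.
  - apply: (@diagonalizable_roots _ _ _
      [:: (e, a); (adjoint e, - a); (f, b); (adjoint f, - b);
          (1 - (e + (adjoint e + (f + adjoint f))), 0)]).
      rewrite !big_cons big_nil /= addr0.
      by rewrite (addrA f) (addrA (adjoint e)) (addrA e) addrC subrK.
    move=> p; rewrite !inE => /or4P [|||/orP []] /eqP -> //=.
    rewrite mulrBr mulr1 !mulrDr he' hae hf' haf scale0r.
    by rewrite /h !scalerBr !scaleNr !addrA subrr.
by apply/eqP; move/eqP: he'; rewrite h0 mul0r eq_sym scaler_eq0 (negPf strf).
Qed.

(** Take for [f] a nonzero hyperbolic idempotent if there is one, else 0. A splitting of [f], or a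
    nonzero hyperbolic idempotent orthogonal to [f] and $f^\ast$, would give two orthogonal pairs;
    so [f] is primitive or 0, and [sa_split] applies to the rest. *)
Lemma no_torus_decomposition : no_torus -> exists (l : seq 'M[K]_N) f,
  [/\ [/\ \sum_(e <- l) e + (f + adjoint f) = 1, pairwise orthogonal_idem l
        & forall e, e \in l -> [/\ primitive e, adjoint e = e
            & [/\ e * f = 0, f * e = 0, e * adjoint f = 0 & adjoint f * e = 0]]],
      forall e e', e \in l -> e' \in l -> orthogonal_idem e e' -> ~ mx_equiv e e',
      hyperbolic f
    & f = 0 \/ primitive f /\ \tr (s * f) != 0].
Proof.
move=> D.
have [f [hf f0 nohyp]] : exists f, [/\ hyperbolic f, f = 0 \/ primitive f /\ \tr (s * f) != 0
    & forall e, hyperbolic e -> corner (1 - (f + adjoint f)) e -> e = 0].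
  have [[f [hf f0]]|nohyp] := classic (exists f, hyperbolic f /\ f != 0).
    have [cf ff faf aff] := hf; exists f; split=> //.
      right; split; last first.
        by apply: contra f0 => /eqP str0; apply/eqP; exact: hyperbolic_str.
      split=> // f1 [cf1 ff1 f1f] f1f1.
      have af1 : adjoint f1 * adjoint f = adjoint f1 by rewrite -adjointM ff1.
      have faf1 : adjoint f * adjoint f1 = adjoint f1 by rewrite -adjointM f1f.
      (* An element of the corner of [f] times the adjoint of another is 0 in either order, so [f1]
         and [f - f1] form two orthogonal hyperbolic pairs. *)
      have cross u v : u * f = u -> f * u = u -> v * f = v -> f * v = v ->
          u * adjoint v = 0 /\ adjoint v * u = 0.
        move=> uf fu vf fv; have [av va] : adjoint v * adjoint f = adjoint v
            /\ adjoint f * adjoint v = adjoint v by rewrite -!adjointM fv vf.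
        split; first by rewrite -uf -va mulrA -(mulrA u) faf mulr0 mul0r.
        by rewrite -fu -av mulrA -(mulrA (adjoint v)) aff mulr0 mul0r.
      pose f2 := f - f1.
      have ff2 : f * f2 = f2 by rewrite mulrBr ff ff1.
      have f2f : f2 * f = f2 by rewrite mulrBl ff f1f.
      have f2f2 : f2 * f2 = f2 by rewrite mulrBr f2f mulrBl ff1 f1f1 subrr subr0.
      have [a1 a2] := cross _ _ f1f ff1 f1f ff1.
      have [a3 a4] := cross _ _ f2f ff2 f2f ff2.
      have [a5 a6] := cross _ _ f1f ff1 f2f ff2.
      case: (@hyperbolic_orthogonal f1 f2) => //.
      - by split=> //; exact: even_centB.
      - by rewrite mulrBr f1f f1f1 subrr.
      - by rewrite mulrBl ff1 f1f1 subrr.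
      - by left.
      - by move/eqP; rewrite subr_eq0 => /eqP ->; right.
    move=> e he [ce ge eg].
    have faf_ : adjoint f * adjoint f = adjoint f by rewrite -adjointM ff.
    have ef : e * f = 0 by rewrite -eg -mulrA mulrBl mul1r mulrDl ff aff addr0 subrr mulr0.
    have fe : f * e = 0 by rewrite -ge mulrA mulrBr mulr1 mulrDr ff faf addr0 subrr mul0r.
    have eaf : e * adjoint f = 0.
      by rewrite -eg -mulrA mulrBl mul1r mulrDl faf faf_ add0r subrr mulr0.
    have afe : adjoint f * e = 0.
      by rewrite -ge mulrA mulrBr mulr1 mulrDr aff faf_ add0r subrr mul0r.
    case: (hyperbolic_orthogonal D he hf) => // f0'.
    by rewrite f0' eqxx in f0.
  exists 0; split; last 1 first.
  - move=> e he _; apply: NNPP => e0; apply: nohyp; exists e; split=> //; exact/eqP.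
  - by split; rewrite ?mul0r ?mulr0 //; exact: even_cent0.
  - by left.
have [cf ff faf aff] := hf; have caf := adjoint_even_cent cf.
have afaf : adjoint f * adjoint f = adjoint f by rewrite -adjointM ff.
pose g := 1 - (f + adjoint f).
have cg : even_cent g by apply/even_centB/even_centD => //; exact: even_cent1.
have gf : g * f = 0 by rewrite mulrBl mul1r mulrDl ff aff addr0 subrr.
have fg : f * g = 0 by rewrite mulrBr mulr1 mulrDr ff faf addr0 subrr.
have gaf : g * adjoint f = 0 by rewrite mulrBl mul1r mulrDl faf afaf add0r subrr.
have afg : adjoint f * g = 0 by rewrite mulrBr mulr1 mulrDr aff afaf add0r subrr.
have gg : g * g = g by rewrite {2}/g mulrBr mulr1 mulrDr gf gaf addr0 subr0.
have ag : adjoint g = g by rewrite adjointB adjoint1 adjointD adjointK [_ + f]addrC.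
have [l [suml orth inl]] := sa_split cg gg ag nohyp.
exists l, f; split=> //.
- split=> // [|e /inl [pe ae [_ ge eg]]]; first by rewrite suml subrK.
  split=> //; split.
  + by rewrite -eg -mulrA gf mulr0.
  + by rewrite -ge mulrA fg mul0r.
  + by rewrite -eg -mulrA gaf mulr0.
  + by rewrite -ge mulrA afg mul0r.
(* An equivalence would produce a nonzero hyperbolic idempotent in the corner of [e + e'], hence in
   that of [g]. *)
- move=> e e' /inl [[e0 ce ee _] ae [_ ge eg]] /inl [[_ ce' ee' _] ae' [_ ge' eg']].
  move=> /andP [/eqP eoe' /eqP e'oe] eqv.
  have [u [hu [cu uu1 uu2] /eqP []]] := equiv_hyperbolic ee ee' ce ce' ae ae' eoe' e'oe e0 eqv.
  apply: nohyp => //; split=> //.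
    by rewrite -uu1 mulrA [_ * (e + e')]mulrDr ge ge'.
  by rewrite -uu2 -mulrA [(e + e') * _]mulrDl eg eg'.
Qed.

(** With $T - ae$ nilpotent, so is its adjoint $-(T + ae)$; for $a \neq 0$ this is possible only if
    $e = 0$. *)
Lemma skew_local_nilp e T : local_idem e -> adjoint e = e -> corner e T ->
  adjoint T = - T -> exists k, T ^+ k = 0.
Proof.
move=> le ae cT aT; have [ce ee _] := le; have [_ eT Te] := cT.
have [a [k Tak]] := local_eigen le cT.
have [a0|a0] := eqVneq a 0; first by exists k; rewrite -Tak a0 scale0r subr0.
suff e0 : e = 0 by exists 1%N; rewrite expr1 -eT e0 mul0r.
apply: (@coprime_nilp _ _ (T - a *: e) e e (a + a) k k) => //.
- by rewrite -mulr2n -mulr_natr mulf_neq0 ?(two_neq0 charK).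
- by rewrite mulrBl mulrBr mxscaleAl mxscaleAr eT Te.
- by rewrite Tak mul0r.
have -> : T - a *: e + (a + a) *: e = - adjoint (T - a *: e).
  by rewrite adjointB adjointZ aT ae -opprD opprK scalerDl addrA subrK.
by rewrite exprNn -adjointX Tak adjoint0 mulr0 mul0r.
Qed.

Lemma odd_str e : even_cent e -> e * e = e -> odd (\rank e) -> \tr (s * e) != 0.
Proof.
move=> ce ee; have [a Da] := idem_sdim charK ss ce ee.
apply: contraL => /eqP str0; move: Da; rewrite str0 add0r => /(natr_inj charK) ->.
by rewrite odd_double.
Qed.

Lemma str_compress (I : finType) (E : I -> 'M[K]_N) h :
    (forall i, even_cent (E i)) -> (forall i, E i * E i = E i) -> \sum_i E i = 1 ->
  \tr (s * h) = \sum_i \tr (s * (E i * h * E i)).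
Proof.
move=> cE EE sumE; rewrite -{1}[h]mul1r -sumE mulr_suml mulr_sumr raddf_sum.
apply: eq_bigr => i _ /=; have [_ sE] := cE i.
rewrite !mulrA [RHS]mxtrace_mulC -[E i *m _]/(_ * _) !mulrA -sE.
by rewrite -(mulrA s (E i) (E i)) EE.
Qed.

(** The criterion [cent_nilp] applies to the family of the [E i], [f] and $f^\ast$: diagonal blocks
    are nilpotent by skewness and zero supertrace, and the inequivalences involving [f] or $f^\ast$
    follow from rank parity and supertrace. *)
Lemma decomposition_nilp p (E : 'I_p -> 'M[K]_N) f h :
    (forall i, [/\ primitive (E i), adjoint (E i) = E i & ~~ odd (\rank (E i))]) ->
    (forall i j, i != j -> ~ mx_equiv (E i) (E j)) ->
    f = 0 \/ [/\ primitive f, primitive (adjoint f) & odd (\rank f)] ->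
    \sum_i E i + (f + adjoint f) = 1 ->
    even_cent h -> adjoint h = - h -> \tr (s * h) = 0 ->
  exists k, h ^+ k = 0.
Proof.
move=> hE nonequiv hf sumE ch ah str_h.
pose E' (i : 'I_p + bool) := match i with
  | inl i => E i | inr b => if b then adjoint f else f end.
have locf : local_idem f /\ local_idem (adjoint f).
  case: hf => [->|[pf paf _]]; first by rewrite adjoint0; split; exact: local0.
  by split; exact: primitive_local.
have locE i : local_idem (E' i).
  by case: i => [i|[]] /=; [have [/primitive_local] := hE i | case: locf..].
have sumE' : \sum_i E' i = 1.
  by rewrite big_sumType big_bool /= [adjoint f + f]addrC.
have cE i : even_cent (E' i) by have [] := locE i.
have EE i : E' i * E' i = E' i by have [] := locE i.
have nilpE i : exists k, (E i * h * E i) ^+ k = 0.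
  have [/primitive_local le ae _] := hE i; have [ce ee _] := le.
  apply: (skew_local_nilp le ae (corner_compress ce ee ch)).
  by rewrite !adjointM ae ah mulNr mulrN mulrA.
have afaf : adjoint (f * h * f) = - (adjoint f * h * adjoint f).
  by rewrite !adjointM ah mulNr mulrN mulrA.
(* Here $fhf - af$ is nilpotent. The blocks at [f] and $f^\ast$ have the same supertrace and the
   [E i] contribute 0, so $2a \operatorname{str} f = 0$; odd rank makes $\operatorname{str} f \neq
   0$. *)
have nilpf : exists k, (f * h * f) ^+ k = 0.
  have [lf _] := locf; have [cf ff _] := lf.
  case: hf => [->|[pf _ /(odd_str cf ff) strf]]; first by exists 1%N; rewrite mulr0 expr1.
  have [a [k fhk]] := local_eigen lf (corner_compress cf ff ch).
  have strfhf : \tr (s * (f * h * f)) = a * \tr (s * f).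
    apply/eqP; rewrite -subr_eq0 -mxtraceZ -raddfB /= -mxscaleAr -mulrBr.
    apply/eqP/(@even_cent_nilp_str _ _ x)/fhk; apply/even_centB/even_centZ => //.
    by do 2?apply: even_centM.
  have a0 : a = 0.
    move: str_h; rewrite (str_compress h cE EE sumE') big_sumType big_bool /= big1 => [|i _].
      rewrite add0r -[adjoint f * h * _]opprK -afaf mulrN raddfN /= str_adjoint opprK.
      rewrite -mulr2n -mulr_natl strfhf => /eqP.
      by rewrite !mulf_eq0 (negPf (two_neq0 charK)) (negPf strf) orbF => /eqP.
    have [k' Ehk] := nilpE i; apply: (@even_cent_nilp_str _ _ x _ _ _ _ Ehk).
    have [[_ ce _ _] _ _] := hE i; by do 2?apply: even_centM.
  by exists k; rewrite -fhk a0 scale0r subr0.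
apply: (cent_nilp charK ch locE sumE') => [i j T S nij cT cS|[i|[]] //=]; last first.
  have [k fhk] := nilpf; exists k.
  by rewrite -[adjoint f * _ * _]opprK -afaf exprNn -adjointX fhk adjoint0 mulr0.
have : [\/ E' i = 0, E' j = 0 | [/\ primitive (E' i), primitive (E' j)
    & ~ mx_equiv (E' i) (E' j)]].
  have rk_af : \rank (adjoint f) = \rank f.
    have [[_ ff _] [_ aff _]] := locf.
    by apply: (natr_inj charK); rewrite -!idem_trace // mxtrace_adjoint.
  (* Equivalence preserves the rank, which is even for [E k]. *)
  have odd_even k e : e * e = e -> odd (\rank e) -> ~ mx_equiv (E k) e /\ ~ mx_equiv e (E k).
    move=> ee odde; have [[_ _ EEk _] _ evk] := hE k.
    split=> /mx_equiv_rank [] // => [|rk]; first by move=> rk _; rewrite rk odde in evk.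
    by rewrite -rk odde in evk.
  case: hf => [f0|[pf paf oddf]].
    case: i j nij => [i|b] [j|b'] nij.
    - apply: Or33; have [pi _ _] := hE i; have [pj _ _] := hE j; split=> //.
      by apply: nonequiv; apply: contraNneq nij => ->.
    - by apply: Or32; rewrite /E' f0; case: (b'); rewrite ?adjoint0.
    - by apply: Or31; rewrite /E' f0; case: (b); rewrite ?adjoint0.
    - by apply: Or31; rewrite /E' f0; case: (b); rewrite ?adjoint0.
  apply: Or33; have pE k : primitive (E' k).
    by case: k => [k|[]] //=; have [] := hE k.
  split=> //; case: i j nij => [i|b] [j|b'] nij /=.
  - by apply: nonequiv; apply: contraNneq nij => ->.
  - case: b' nij => _; first by apply: (odd_even _ _ (EE (inr true)) _).1; rewrite /= rk_af.
    exact: (odd_even _ _ (EE (inr false)) _).1.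
  - case: b nij => _; first by apply: (odd_even _ _ (EE (inr true)) _).2; rewrite /= rk_af.
    exact: (odd_even _ _ (EE (inr false)) _).2.
  have strf := odd_str (cE (inr false)) (EE (inr false)) oddf.
  (* Equivalence preserves the supertrace, but those of [f] and $f^\ast$ are opposite and
     nonzero. *)
  have nfaf : ~ mx_equiv f (adjoint f).
    move=> /(mx_equiv_rank charK (EE (inr false)) (EE (inr true))) [_ /=].
    rewrite str_adjoint => /eqP; rewrite -subr_eq0 opprK -mulr2n -mulr_natl mulf_eq0.
    by rewrite (negPf (two_neq0 charK)) (negPf strf).
  by case: b b' nij => [] [] //= _ /mx_equiv_sym.
case=> [->|->|[pi pj neq]].
- by exists 1%N; rewrite mulr0 expr1.
- by exists 1%N; rewrite mulr0 !mul0r expr1.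
exact: (primitive_nonequiv pi pj neq cT cS).
Qed.

End Involution.

(** * Submodules and idempotents *)

Section Projections.
Variables (K : fieldType) (N : nat).
Implicit Types (A e : 'M[K]_N) (U : {vspace 'cV[K]_N}).

Lemma mulmx_ext A e : (forall v : 'cV[K]_N, A *m v = e *m v) -> A = e.
Proof.
move=> Ae; apply/matrixP => i j.
by have /matrixP/(_ i 0) := Ae (delta_mx j 0); rewrite -!colE !mxE.
Qed.

Lemma mx_of_linear (f : 'cV[K]_N -> 'cV[K]_N) : linear f ->
  exists A, forall v, A *m v = f v.
Proof.
move=> lf.
have f0 : f 0 = 0 by have := lf (-1) 0 0; rewrite scaleN1r oppr0 addr0 scaleN1r addNr.
have fD u v : f (u + v) = f u + f v by have := lf 1 u v; rewrite !scale1r.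
have fZ a u : f (a *: u) = a *: f u by have := lf a u 0; rewrite !addr0 f0 addr0.
exists (\matrix_(i, j) f (delta_mx j 0) i 0) => v; apply/colP => i.
rewrite [v in RHS]matrix_sum_delta (eq_bigr (fun j => v j 0 *: delta_mx j 0)) => [|j _].
  rewrite (big_morph f fD f0) summxE mxE; apply: eq_bigr => j _.
  by rewrite fZ !mxE mulrC.
by rewrite big_ord1.
Qed.

(** An idempotent with image [U]; its kernel, a complement of [U], is left open. *)
Definition projects e U := (forall v, e *m v \in U) /\ (forall v, v \in U -> e *m v = v).

Lemma projects_idem e U : projects e U -> e *m e = e.
Proof. by move=> [eU Ue]; apply: mulmx_ext => v; rewrite -mulmxA Ue. Qed.

Lemma projects_mem e U v : projects e U -> (v \in U) = (e *m v == v).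
Proof.
by move=> [eU Ue]; apply/idP/eqP => [/Ue //|<-]; exact: eU.
Qed.

(** Factor $e = XY$ with the columns of [X] a basis of [U] and [Y] the coordinates of $ev$; then $YX
    = 1$. *)
Lemma projects_trace e U : projects e U -> \tr e = (\dim U)%:R.
Proof.
move=> [eU Ue]; pose b := vbasis U.
pose X : 'M[K]_(N, \dim U) := \matrix_(i, j) b`_j i 0.
pose Y : 'M[K]_(\dim U, N) := \matrix_(j, k) coord b j (e *m delta_mx k 0).
have eXY : e = X *m Y.
  apply/matrixP => i k; have := coord_vbasis (eU (delta_mx k 0)).
  move/(congr1 (fun v : 'cV_N => v i 0)); rewrite -colE mxE => ->.
  by rewrite summxE mxE; apply: eq_bigr => j _; rewrite !mxE mulrC colE.
have YX : Y *m X = 1%:M.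
  apply/matrixP => j l; rewrite !mxE.
  have bl : b`_l \in U by rewrite vbasis_mem // mem_nth // size_tuple.
  rewrite eq_sym -(coord_free l j (basis_free (vbasisP U))) -{1}(Ue _ bl).
  have -> : e *m b`_l = \sum_k b`_l k 0 *: (e *m delta_mx k 0).
    rewrite {1}[b`_l]matrix_sum_delta mulmx_sumr; apply: eq_bigr => k _.
    by rewrite big_ord1 -scalemxAr.
  by rewrite linear_sum; apply: eq_bigr => k _; rewrite linearZ !mxE mulrC.
by rewrite eXY mxtrace_mulC YX mxtrace1.
Qed.

Definition mximg e : {vspace 'cV[K]_N} := limg (linfun (mulmx e : 'cV[K]_N -> 'cV[K]_N)).

Lemma projects_mximg e : e *m e = e -> projects e (mximg e).
Proof.
move=> ee; split=> v.
  by have := memv_img (linfun (mulmx e : 'cV[K]_N -> 'cV[K]_N)) (memvf v); rewrite lfunE.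
by case/memv_imgP => u _ ->; rewrite lfunE /= mulmxA ee.
Qed.

(** The last clause, a consequence of the uniqueness of components, serves to place the projections
    in the even centralizer. *)
Lemma directv_projections (I : finType) (U : I -> {vspace 'cV[K]_N}) :
    (\sum_i U i)%VS = fullv -> directv (\sum_i U i) ->
  exists E : I -> 'M[K]_N, [/\ forall i, projects (E i) (U i), \sum_i E i = 1%:M
    & forall (y : 'M[K]_N), (forall i v, v \in U i -> y *m v \in U i) ->
        forall i, y *m E i = E i *m y].
Proof.
move=> sumU dirU.
have uniqU (us vs : I -> 'cV[K]_N) : (forall i, us i \in U i) -> (forall i, vs i \in U i) ->
    \sum_i us i = \sum_i vs i -> forall i, us i = vs i.
  move=> Uu Uv uv i; have /directv_sum_unique dU := dirU.
  have /esym := dU us vs (fun i _ => Uu i) (fun i _ => Uv i).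
  by rewrite uv eqxx => /forallP/(_ i)/eqP.
have [P PE] : exists P : I -> 'End('cV[K]_N), (forall i v, P i v \in U i)
    /\ forall v, \sum_i P i v = v.
  exists (sumv_pi_for (esym sumU)); split=> [i v|v]; first exact: memv_sum_pi.
  by rewrite sumv_pi_sum ?memvf.
case: PE => PU Psum.
have /fin_all_exists [E EP] : forall i, exists A, forall v, A *m v = P i v.
  by move=> i; apply: mx_of_linear => a u v; rewrite linearP.
exists E; split=> [i||y yU i].
- split=> v; rewrite EP // => vU.
  suff /(_ i) : forall j, P j v = if j == i then v else 0 by rewrite eqxx.
  apply: (uniqU (fun j => P j v) (fun j => if j == i then v else 0)) => [//|j|].
    by case: eqP => [->|] //; rewrite mem0v.
  by rewrite Psum -big_mkcond big_pred1_eq.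
- apply: mulmx_ext => v; rewrite mulmx_suml mul1mx -[RHS]Psum.
  by apply: eq_bigr => i _; rewrite EP.
- apply: mulmx_ext => v; rewrite -!mulmxA !EP.
  apply: (uniqU (fun i => y *m P i v) (fun i => P i (y *m v))) => [j|//|].
    exact: yU.
  by rewrite -mulmx_sumr !Psum.
Qed.

End Projections.

(** * The parity operator of $\Bbbk^{n|n}$ *)

Section Superspace.
Variables (K : closedFieldType) (n : nat).
Hypothesis charK : [pchar K] =i pred0.
Local Notation cV := 'cV[K]_(n + n).
Implicit Types (T X e f : 'M[K]_(n + n)) (v w : cV).

Definition parity_mx : 'M[K]_(n + n) := diag_mx (row_mx (const_mx 1) (const_mx (-1))).
Local Notation s := parity_mx.

Lemma parity_block : s = block_mx 1%:M 0 0 (- 1%:M).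
Proof. by rewrite /parity_mx diag_mx_row !diag_const_mx raddfN. Qed.

Lemma parity_sq : s * s = 1.
Proof.
rewrite -[_ * _]/(_ *m _) parity_block mulmx_block !mul0mx !mulmx0 !mulmx1 mulNmx mulmxN.
by rewrite opprK mulmx1 !addr0 add0r -scalar_mx_block.
Qed.

Lemma parity_col v : s *m v = col_mx (usubmx v) (- dsubmx v).
Proof.
by rewrite parity_block -{1}[v]vsubmxK mul_block_col !mul0mx mulNmx !mul1mx addr0 add0r.
Qed.

Lemma oppr_self m p (u : 'M[K]_(m, p)) : - u = u -> u = 0.
Proof.
move=> /eqP; rewrite -subr_eq0 -opprD oppr_eq0 -mulr2n -scaler_nat scaler_eq0.
by rewrite (negPf (two_neq0 charK)) => /eqP.
Qed.

Lemma mem_std_gr b v : (v \in std_gr K n b) <-> s *m v = (-1) ^+ b *: v.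
Proof.
rewrite parity_col; split=> [/std_grP|].
  case: b => /= vb; rewrite -[v in RHS]vsubmxK vb ?oppr0 ?expr0 ?scale1r //.
  by rewrite expr1 scaleN1r opp_col_mx oppr0.
move=> sv; apply/std_grP; move: sv; rewrite -[v in _ *: v]vsubmxK.
case: b; first by rewrite expr1 scaleN1r opp_col_mx => /eq_col_mx [/esym/oppr_self].
by rewrite expr0 scale1r => /eq_col_mx [_ /oppr_self].
Qed.

Lemma homog_even X : homog false X <-> s * X = X * s.
Proof.
rewrite -[s * X]/(s *m X) -[X * s]/(X *m s) /homog /= parity_block -[X]submxK.
move: (ulsubmx X) (ursubmx X) (dlsubmx X) (drsubmx X) => A B C D.
rewrite block_mxKul block_mxKdr !mulmx_block !mul0mx !mulmx0 !mulmxN !mulNmx !mulmx1 !mul1mx.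
rewrite !addr0 !add0r; split=> [/eq_block_mx [_ <- <- _]|]; first by rewrite oppr0.
by move=> /eq_block_mx [_ /esym/oppr_self -> /oppr_self -> _].
Qed.

Lemma homog_odd X : homog true X -> s * X = - (X * s).
Proof.
rewrite -[s * X]/(s *m X) -[X * s]/(X *m s) /homog /= parity_block => <-.
rewrite !mulmx_block !mul0mx !mulmx0 !mulmxN !mulNmx !mulmx1 !mul1mx.
by rewrite opp_block_mx !addr0 !add0r !oppr0 opprK.
Qed.

Lemma part_other b X : homog b X -> part (~~ b) X = 0.
Proof.
by case: b => <- /=; rewrite ?block_mxKul ?block_mxKur ?block_mxKdl ?block_mxKdr block_mx0.
Qed.

Lemma str_parity X : str X = \tr (s * X).
Proof.
rewrite -[s * X]/(s *m X) parity_block -[X in RHS]submxK mulmx_block !mul0mx !addr0 !add0r.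
by rewrite mxtrace_block mulNmx !mul1mx raddfN.
Qed.

End Superspace.

(** * Submodules of $V$ and idempotents of the even centralizer *)

Section Submodules.
Variables (K : closedFieldType) (n : nat) (x : 'M[K]_(n + n)) (hx : homog true x).
Hypothesis charK : [pchar K] =i pred0.
Local Notation cV := 'cV[K]_(n + n).
Local Notation s := (parity_mx K n).
Local Notation V := (std_mod hx).
Local Notation even_cent := (even_cent x s).
Local Notation corner := (corner x s).
Local Notation primitive := (primitive x s).
Local Notation mx_equiv := (mx_equiv x s).
Implicit Types (U : submod V) (T e f : 'M[K]_(n + n)) (v w : cV).

Lemma std_actE v : kx_act V v = x *m v.
Proof. by rewrite /= lfunE. Qed.

Lemma submod_act U v : v \in sm_space U -> x *m v \in sm_space U.
Proof.
by move=> vU; rewrite -std_actE; apply: (subvP (sm_stable U)); rewrite memv_img.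
Qed.

Lemma submod_parity U v : v \in sm_space U -> s *m v \in sm_space U.
Proof.
rewrite -{1}(sm_graded U) => /memv_addP [a /memv_capP [aU a0] [b /memv_capP [bU b1] ->]].
move/(mem_std_gr charK): a0 => sa; move/(mem_std_gr charK): b1 => sb.
by rewrite mulmxDr sa sb expr0 expr1 rpredD // rpredZ.
Qed.

(** The explicit formulas are recorded because they show that any [s]-stable subspace containing [v]
    contains both components. *)
Lemma parity_split v : exists a b, [/\ v = a + b, s *m a = a, s *m b = - b,
  a = 2^-1 *: (v + s *m v) & b = 2^-1 *: (v - s *m v)].
Proof.
have ssv : s *m (s *m v) = v.
  by rewrite mulmxA -[s *m s]/(s * s) parity_sq mul1mx.
exists (2^-1 *: (v + s *m v)), (2^-1 *: (v - s *m v)); split=> //.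
- rewrite -scalerDr addrACA subrr addr0 -mulr2n -scaler_nat scalerA mulVf ?scale1r //.
  exact: two_neq0.
- by rewrite -scalemxAr mulmxDr ssv addrC.
- by rewrite -scalemxAr mulmxBr ssv -scalerN opprB.
Qed.

Lemma exists_submod (A : {vspace cV}) :
  (forall v, v \in A -> x *m v \in A) -> (forall v, v \in A -> s *m v \in A) ->
  exists U : submod V, sm_space U = A.
Proof.
move=> xA sA.
have gA : (A :&: kx_gr V false + A :&: kx_gr V true)%VS = A.
  apply/eqP; rewrite eqEsubv subv_add !capvSl /=; apply/subvP => v vA.
  have [a [b [vab sa sb Da Db]]] := parity_split v.
  have aG : a \in std_gr K n false by apply/(mem_std_gr charK); rewrite expr0 scale1r.
  have bG : b \in std_gr K n true by apply/(mem_std_gr charK); rewrite expr1 scaleN1r.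
  have aA : a \in A by rewrite Da rpredZ // rpredD // sA.
  have bA : b \in A by rewrite Db rpredZ // rpredB // sA.
  by apply/memv_addP; exists a; [|exists b]; rewrite ?memv_cap ?aA ?bA.
have stA : (kx_act V @: A <= A)%VS.
  by apply/subvP => _ /memv_imgP [v vA ->]; rewrite std_actE xA.
by exists (@SubMod K V A gA stA).
Qed.

Local Notation S U := (subvs_of (sm_space U)).

Lemma vsval_linear U a (u w : S U) :
  vsval (a *: u + w) = a *: (vsval u : cV) + (vsval w : cV) :> cV.
Proof. exact: linearP. Qed.

Lemma vsval_add U (u w : S U) : vsval (u + w) = (vsval u : cV) + (vsval w : cV) :> cV.
Proof. exact: linearD. Qed.

Lemma vsval_sub U (u w : S U) : vsval (u - w) = (vsval u : cV) - (vsval w : cV) :> cV.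
Proof. exact: linearB. Qed.

Lemma vsval_scale U a (u : S U) : vsval (a *: u) = a *: (vsval u : cV) :> cV.
Proof. exact: linearZ. Qed.

Lemma vsval0 U : vsval (0 : S U) = 0 :> cV.
Proof. exact: linear0. Qed.

Lemma vsproj_linear U a v w : vsproj (sm_space U) (a *: v + w) =
  a *: vsproj (sm_space U) v + vsproj (sm_space U) w.
Proof. exact: (@linearP _ _ _ _ (vsproj (sm_space U))). Qed.

Definition sub_parity U (u : S U) : S U := vsproj (sm_space U) (s *m vsval u).

Lemma sub_parityE U (u : S U) : vsval (sub_parity u) = s *m vsval u.
Proof. by rewrite /sub_parity vsprojK // submod_parity // subvsP. Qed.

Lemma sub_parityD U (u w : S U) : sub_parity (u + w) = sub_parity u + sub_parity w.
Proof. by apply: subvs_inj; rewrite vsval_add !sub_parityE vsval_add mulmxDr. Qed.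

Lemma sub_act_mulmx U (u : S U) : vsval (sub_act U u) = x *m vsval u.
Proof. by rewrite sub_actE std_actE. Qed.

Lemma mem_sub_gr_parity U b (u : S U) :
  (u \in kx_gr (kx_sub U) b) <-> sub_parity u = (-1) ^+ b *: u.
Proof.
rewrite [u \in _](mem_sub_gr b u); split=> [/(mem_std_gr charK) su|su].
  by apply: subvs_inj; rewrite sub_parityE su linearZ.
by apply/(mem_std_gr charK); rewrite -sub_parityE su linearZ.
Qed.

Lemma sub_submod_parity U (A : submod (kx_sub U)) (u : S U) :
  u \in sm_space A -> sub_parity u \in sm_space A.
Proof.
rewrite -{1}(sm_graded A) => /memv_addP [a /memv_capP [aU a0] [b /memv_capP [bU b1] ->]].
move/mem_sub_gr_parity: a0 => sa; move/mem_sub_gr_parity: b1 => sb.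
by rewrite sub_parityD sa sb expr0 expr1 rpredD // rpredZ.
Qed.

Lemma sub_submod_act U (A : submod (kx_sub U)) (u : S U) :
  u \in sm_space A -> sub_act U u \in sm_space A.
Proof. by move=> uA; apply: (subvP (sm_stable A)); rewrite memv_img. Qed.

Lemma projects_vsproj U e v : projects e (sm_space U) ->
  vsval (vsproj (sm_space U) (e *m v)) = e *m v.
Proof. by move=> [eU _]; exact: vsprojK (eU v). Qed.

Lemma projects_vsval U e (u : S U) : projects e (sm_space U) -> e *m vsval u = vsval u.
Proof. by move=> [_ Ue]; rewrite Ue // subvsP. Qed.

Lemma exists_sub_submod U (A : {vspace S U}) :
  (forall u, u \in A -> sub_act U u \in A) -> (forall u, u \in A -> sub_parity u \in A) ->
  exists B : submod (kx_sub U), sm_space B = A.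
Proof.
move=> xA sA.
have gA : (A :&: kx_gr (kx_sub U) false + A :&: kx_gr (kx_sub U) true)%VS = A.
  apply/eqP; rewrite eqEsubv subv_add !capvSl /=; apply/subvP => u uA.
  have [a [b [vab sa sb Da Db]]] := parity_split (vsval u).
  pose a' : S U := 2^-1 *: (u + sub_parity u); pose b' : S U := 2^-1 *: (u - sub_parity u).
  have va : vsval a' = a.
    by rewrite vsval_scale vsval_add sub_parityE Da.
  have vb : vsval b' = b.
    by rewrite vsval_scale vsval_sub sub_parityE Db.
  have aG : a' \in kx_gr (kx_sub U) false.
    by apply/mem_sub_gr_parity/subvs_inj; rewrite expr0 scale1r sub_parityE va.
  have bG : b' \in kx_gr (kx_sub U) true.
    apply/mem_sub_gr_parity/subvs_inj; rewrite expr1 scaleN1r sub_parityE vb sb.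
    by rewrite -scaleN1r vsval_scale vb scaleN1r.
  have aA : a' \in A by rewrite rpredZ // rpredD // sA.
  have bA : b' \in A by rewrite rpredZ // rpredB // sA.
  apply/memv_addP; exists a'; first by rewrite memv_cap aA.
  exists b'; first by rewrite memv_cap bA.
  by apply: subvs_inj; rewrite vsval_add va vb.
have stA : (kx_act (kx_sub U) @: A <= A)%VS.
  by apply/subvP => _ /memv_imgP [u uA ->]; exact: xA.
by exists (@SubMod K (kx_sub U) A gA stA).
Qed.

Lemma daddv_pi_comm (vT : vectType K) (A B : {vspace vT}) (g : vT -> vT) :
    (A :&: B = 0)%VS -> (A + B = fullv)%VS ->
    (forall u z : vT, g (u + z) = g u + g z) ->
    (forall u, u \in A -> g u \in A) -> (forall u, u \in B -> g u \in B) ->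
  forall u, daddv_pi A B (g u) = g (daddv_pi A B u).
Proof.
move=> AB0 ABf gD gA gB u.
have BA0 : (B :&: A = 0)%VS by rewrite capvC.
have dec z : daddv_pi A B z + daddv_pi B A z = z by rewrite daddv_pi_add // ABf memvf.
have pB z : z \in B -> daddv_pi A B z = 0.
  by move=> wB; have /eqP := dec z; rewrite (daddv_pi_id BA0) // -subr_eq0 addrK => /eqP.
rewrite -{1}(dec u) gD linearD /= [X in _ + X]pB ?addr0 ?gB ?memv_pi //.
by rewrite (daddv_pi_id AB0) // gA // memv_pi.
Qed.

(** Take the matrix of $v \mapsto g(ev)$, that is, [g] extended by 0 on the kernel of [e]. This
    turns morphisms of submodules into elements of $C$. *)
Lemma sub_hom_mx U U' e e' (g : S U -> S U') :
    projects e (sm_space U) -> projects e' (sm_space U') -> even_cent e ->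
    (forall a (u z : S U), g (a *: u + z) = a *: g u + g z) ->
    (forall u, g (sub_act U u) = sub_act U' (g u)) ->
    (forall u, g (sub_parity u) = sub_parity (g u)) ->
  exists f, [/\ even_cent f, e' * f = f, f * e = f & forall u, vsval (g u) = f *m vsval u].
Proof.
move=> prU prU' ce lg gx gs.
have [|f fE] := @mx_of_linear _ _ (fun v => vsval (g (vsproj (sm_space U) (e *m v)))).
  move=> a v w; rewrite mulmxDr -scalemxAr vsproj_linear lg; exact: vsval_linear.
have fu u : vsval (g u) = f *m vsval u by rewrite fE (projects_vsval _ prU) vsvalK.
exists f; split=> //; first split.
- apply: mulmx_ext => v; rewrite -[_ *m v]mulmxA -[f * x *m v]mulmxA !fE -sub_act_mulmx -gx.
  congr (vsval (g _)); apply: subvs_inj.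
  rewrite sub_act_mulmx !(projects_vsproj _ prU) !mulmxA.
  by case: ce => xe _; congr (_ *m _).
- apply: mulmx_ext => v; rewrite -[_ *m v]mulmxA -[f * s *m v]mulmxA !fE -sub_parityE -gs.
  congr (vsval (g _)); apply: subvs_inj.
  rewrite sub_parityE !(projects_vsproj _ prU) !mulmxA.
  by case: ce => _ se; congr (_ *m _).
- by apply: mulmx_ext => v; rewrite -[_ *m v]mulmxA fE (projects_vsval _ prU').
- apply: mulmx_ext => v; rewrite -[_ *m v]mulmxA !fE mulmxA.
  by rewrite (projects_idem prU).
Qed.

(** An idempotent [f] of $eCe$ splits [U] into the images of [f] and [e - f]; conversely the
    projection of a splitting of [U] extends to an idempotent of $eCe$. *)
Lemma indecomposable_primitive U e : projects e (sm_space U) -> even_cent e ->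
  indecomposable (kx_sub U) <-> primitive e.
Proof.
move=> prU ce; have ee := projects_idem prU.
have vsprojK_e v := projects_vsproj v prU; have e_vsval u := projects_vsval u prU.
split=> [[U0 indU]|[e0 _ _ prim]].
  have sub f : corner e f -> f * f = f ->
      exists A : submod (kx_sub U), forall u : S U, (u \in sm_space A) = (f *m vsval u == vsval u).
    move=> [[xf sf] ef fe] ff.
    have memA u : (u \in (sub_incl U @^-1: mximg f)%VS) = (f *m vsval u == vsval u).
      by rewrite -memv_preim sub_inclE (projects_mem _ (projects_mximg ff)).
    have [||A DA] := @exists_sub_submod U (sub_incl U @^-1: mximg f)%VS.
    + move=> u; rewrite !memA sub_act_mulmx => /eqP fu; rewrite mulmxA.
      by rewrite -[f *m x]/(f * x) -xf -[_ *m vsval u]mulmxA fu.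
    + move=> u; rewrite !memA sub_parityE => /eqP fu; rewrite mulmxA.
      by rewrite -[f *m s]/(f * s) -sf -[_ *m vsval u]mulmxA fu.
    by exists A => u; rewrite DA memA.
  split=> //.
    apply/eqP => e0; apply: U0; apply/eqP; rewrite -subv0; apply/subvP => u _.
    rewrite memv0; apply/eqP/subvs_inj; rewrite -e_vsval e0 mul0mx.
    by rewrite vsval0.
  move=> f cf ff; have [_ ef fe] := cf.
  have cf' : corner e (e - f) by exact/cornerB/cf/corner_id.
  have ff' : (e - f) * (e - f) = e - f.
    by rewrite mulrBl !mulrBr ef fe ff -[e * e]/(e *m e) ee subrr subr0.
  have [A memA] := sub f cf ff; have [B memB] := sub _ cf' ff'.
  have sub0 (D : submod (kx_sub U)) g : corner e g -> g * g = g ->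
      (forall u : S U, (u \in sm_space D) = (g *m vsval u == vsval u)) ->
      sm_space D = 0%VS -> g = 0.
    move=> [_ eg _] gg memD D0; apply: mulmx_ext => v; rewrite mul0mx.
    have gv : g *m v \in sm_space U by rewrite (projects_mem _ prU) mulmxA -[e *m g]/(e * g) eg.
    have : vsproj (sm_space U) (g *m v) \in sm_space D.
      by rewrite memD vsprojK // mulmxA -[g *m g]/(g * g) gg.
    by rewrite D0 memv0 => /eqP /(congr1 vsval); rewrite vsprojK // => ->.
  case: (indU A B) => [||/(sub0 _ _ cf ff memA)|/(sub0 _ _ cf' ff' memB)].
  - apply/eqP; rewrite eqEsubv subvf /=; apply/subvP => u _.
    have inU g : corner e g -> g *m vsval u \in sm_space U.
      by move=> [_ eg _]; rewrite (projects_mem _ prU) mulmxA -[e *m g]/(e * g) eg.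
    apply/memv_addP; exists (vsproj (sm_space U) (f *m vsval u)).
      by rewrite memA vsprojK ?inU // mulmxA -[f *m f]/(f * f) ff.
    exists (vsproj (sm_space U) ((e - f) *m vsval u)).
      by rewrite memB vsprojK ?inU // mulmxA -[_ *m (e - f)]/(_ * (e - f)) ff'.
    apply: subvs_inj; rewrite vsval_add !vsprojK ?inU //.
    by rewrite mulmxBl e_vsval addrC subrK.
  - apply/directv_addP/eqP; rewrite -subv0; apply/subvP => u /memv_capP [].
    rewrite memA memB memv0 => /eqP fu /eqP; rewrite mulmxBl e_vsval fu subrr => u0.
    by apply/eqP/subvs_inj; rewrite -u0 vsval0.
  - by left.
  - by move/eqP; rewrite subr_eq0 => /eqP ->; right.
split=> [U0|A B ABf /directv_addP AB0].
  case/eqP: e0; apply: mulmx_ext => v; rewrite mul0mx -vsprojK_e.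
  have : vsproj (sm_space U) (e *m v) \in (fullv : {vspace kx_sub U}) by rewrite memvf.
  by rewrite U0 memv0 => /eqP ->; rewrite vsval0.
have [|||f [ef cf fe fE]] := @sub_hom_mx U U e e (daddv_pi (sm_space A) (sm_space B)) prU prU ce.
- by move=> a u w; rewrite linearP.
- move=> u; apply: (daddv_pi_comm AB0 ABf) => [v w|v|v]; [exact: linearD | |];
    exact: sub_submod_act.
- move=> u; apply: (daddv_pi_comm AB0 ABf) => [v w|v|v];
    [exact: sub_parityD | exact: sub_submod_parity..].
have {}cf : corner e f by [].
have ff : f * f = f.
  apply: mulmx_ext => v.
  have -> : f * f *m v = f *m (f *m vsval (vsproj (sm_space U) (e *m v))).
    by rewrite vsprojK_e !mulmxA -[f *m f *m e]/(f * f * e) -mulrA fe.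
  rewrite -!fE (daddv_pi_id AB0) ?memv_pi // fE vsprojK_e mulmxA.
  by rewrite -[f *m e]/(f * e) fe.
case: (prim f cf ff) => Df; [left | right]; apply/eqP; rewrite -subv0; apply/subvP => u uD.
  rewrite memv0; apply/eqP/subvs_inj; rewrite -(daddv_pi_id AB0 uD) fE Df mul0mx.
  by rewrite vsval0.
have BA0 : (sm_space B :&: sm_space A = 0)%VS by rewrite capvC.
have uAB : u \in (sm_space A + sm_space B)%VS by rewrite ABf memvf.
have /eqP := daddv_pi_add AB0 uAB.
rewrite (daddv_pi_id BA0 uD) -subr_eq0 addrK => /eqP pu0.
rewrite memv0; apply/eqP/subvs_inj; rewrite -e_vsval -Df -fE pu0.
by rewrite vsval0.
Qed.

Lemma sub_parity_hom U U' (F : 'Hom(kx_sub U, kx_sub U')) :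
    (forall b u, u \in kx_gr (kx_sub U) b -> F u \in kx_gr (kx_sub U') b) ->
  forall u, F (sub_parity u) = sub_parity (F u).
Proof.
move=> Fgr u.
have : u \in (kx_gr (kx_sub U) false + kx_gr (kx_sub U) true)%VS by rewrite kx_gr_add memvf.
case/memv_addP => a a0 [b b1 ->].
have [/Fgr/mem_sub_gr_parity sFa /Fgr/mem_sub_gr_parity sFb] := (a0, b1).
move/mem_sub_gr_parity: a0 => sa; move/mem_sub_gr_parity: b1 => sb.
rewrite sub_parityD sa sb !linearD /= !linearZ /=.
by rewrite [RHS]sub_parityD sFa sFb.
Qed.

(** An isomorphism and its inverse extend to matrices [b] and [a] by [sub_hom_mx]; conversely [b]
    restricts to an isomorphism with inverse [a]. *)
Lemma kx_iso_equiv U U' e e' :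
    projects e (sm_space U) -> projects e' (sm_space U') -> even_cent e -> even_cent e' ->
  kx_iso (kx_sub U) (kx_sub U') <-> mx_equiv e e'.
Proof.
move=> prU prU' ce ce'; split=> [[F [[G FK GK] Fx Fgr]]|[a [b [[ca cb] [ea ae] [eb be] ab ba]]]].
  have Fs := sub_parity_hom Fgr.
  have FP c (u z : S U) : F (c *: u + z) = c *: F u + F z by exact: linearP.
  have [|||b [cb eb be bE]] := @sub_hom_mx U U' e e' F prU prU' ce.
  - by move=> a u z; rewrite linearP.
  - by [].
  - by [].
  have [|||a [ca ea ae aE]] := @sub_hom_mx U' U e' e G prU' prU ce'.
  - by move=> a u z; apply: (can_inj FK); rewrite GK FP !GK.
  - by move=> u; apply: (can_inj FK); rewrite GK [F _]Fx GK.
  - by move=> u; apply: (can_inj FK); rewrite Fs !GK.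
  exists a, b; split=> //; apply: mulmx_ext => v.
    rewrite -be -[_ *m v]mulmxA -[b * e *m v]mulmxA -(projects_vsproj _ prU) -bE -aE FK.
    by [].
  rewrite -ae -[_ *m v]mulmxA -[a * e' *m v]mulmxA -(projects_vsproj _ prU') -aE -bE GK.
  by [].
have bU u : b *m u \in sm_space U' by rewrite (projects_mem _ prU') mulmxA -[e' *m b]/(e' * b) eb.
have aU u : a *m u \in sm_space U by rewrite (projects_mem _ prU) mulmxA -[e *m a]/(e * a) ea.
pose g (u : S U) : S U' := vsproj (sm_space U') (b *m vsval u).
have gE u : vsval (g u) = b *m vsval u by rewrite vsprojK.
have lg : linear g.
  move=> c u z; apply: subvs_inj; rewrite vsval_linear !gE vsval_linear.
  by rewrite mulmxDr -scalemxAr.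
pose gL := GRing.isLinear.Build K (S U) (S U') _ g lg.
pose gl : {linear S U -> S U'} := HB.pack g gL.
have FE u : (linfun gl : 'Hom(kx_sub U, kx_sub U')) u = g u by rewrite lfunE.
exists (linfun gl); split.
- exists (fun w : S U' => vsproj (sm_space U) (a *m vsval w)) => u; rewrite /= FE.
    apply: subvs_inj; rewrite vsprojK // gE mulmxA -[a *m b]/(a * b) ab.
    exact: projects_vsval.
  apply: subvs_inj; rewrite gE vsprojK // mulmxA -[b *m a]/(b * a) ba.
  exact: projects_vsval.
- move=> u; rewrite !FE; apply: subvs_inj; rewrite gE !sub_act_mulmx gE !mulmxA.
  by case: cb => xb _; congr (_ *m _).
- move=> c u /mem_sub_gr_parity su; rewrite FE; apply/mem_sub_gr_parity/subvs_inj.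
  rewrite sub_parityE gE mulmxA vsval_scale gE scalemxAr -vsval_scale -su sub_parityE mulmxA.
  by case: cb => _ sb; congr (_ *m _).
Qed.

End Submodules.

(** * The odd form and the main theorem *)

Section OddForm.
Variables (K : closedFieldType) (n : nat) (B : {biscalar 'cV[K]_(n + n)}).
Hypothesis charK : [pchar K] =i pred0.
Hypothesis oddB : odd_form B.
Hypothesis symB : supersymmetric_form B.
Hypothesis ndgB : nondegenerate_form B.
Local Notation cV := 'cV[K]_(n + n).
Local Notation s := (parity_mx K n).
Implicit Types (T X Y h : 'M[K]_(n + n)) (v w : cV).

Definition gram : 'M[K]_(n + n) := \matrix_(i, j) B (delta_mx i 0) (delta_mx j 0).
Local Notation adjoint := (adjoint gram).

Lemma col_sum_delta m (v : 'cV[K]_m) : v = \sum_i v i 0 *: delta_mx i 0.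
Proof. by rewrite {1}[v]matrix_sum_delta; apply: eq_bigr => i _; rewrite big_ord1. Qed.

Lemma gramE v w : B v w = (v^T *m gram *m w) 0 0.
Proof.
rewrite {1}[w]col_sum_delta linear_sumr mxE; apply: eq_bigr => j _.
rewrite linearZr_LR /= mulrC; congr (_ * _).
rewrite {1}[v]col_sum_delta linear_sumlz mxE; apply: eq_bigr => i _.
by rewrite linearZl_LR !mxE.
Qed.

Lemma form_parity v w : exists a b c d, [/\ v = a + b, w = c + d,
    s *m v = a - b, s *m w = c - d
  & [/\ B a c = 0 /\ B c a = 0, B b d = 0 /\ B d b = 0,
        B a d = B d a & B b c = B c b]].
Proof.
have [a [b [-> sa sb _ _]]] := parity_split charK v.
have [c [d [-> sc sd _ _]]] := parity_split charK w.
have gr0 u : s *m u = u -> u \in std_gr K n false.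
  by move=> su; apply/(mem_std_gr charK); rewrite su expr0 scale1r.
have gr1 u : s *m u = - u -> u \in std_gr K n true.
  by move=> su; apply/(mem_std_gr charK); rewrite su expr1 scaleN1r.
exists a, b, c, d; split; rewrite ?mulmxDr ?sa ?sb ?sc ?sd //; split.
- by split; apply: oddB; apply: gr0.
- by split; apply: oddB; apply: gr1.
- by rewrite (symB (gr0 a sa) (gr1 d sd)) expr0 mul1r.
- by rewrite (symB (gr1 b sb) (gr0 c sc)) expr0 mul1r.
Qed.

(** The sign in supersymmetry concerns only pairs of odd vectors, on which an odd form vanishes. *)
Lemma form_sym v w : B v w = B w v.
Proof.
have [a [b [c [d [-> -> _ _ [[ac ca] [bd db] ad bc]]]]]] := form_parity v w.
by rewrite !linearDl !linearDr /= ac ca bd db ad bc !addr0 !add0r addrC.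
Qed.

(** The form pairs only even with odd vectors, and on these [s] acts with opposite signs. *)
Lemma form_parity_mx v w : B (s *m v) w = - B v (s *m w).
Proof.
have [a [b [c [d [-> -> -> -> [[ac _] [bd _] ad bc]]]]]] := form_parity v w.
by rewrite !linearDl !linearDr !linearNl !linearNr /= ac bd !subr0 add0r sub0r opprD opprK.
Qed.

Lemma form_ext v w : (forall u, B u v = B u w) -> v = w.
Proof.
move=> uvw; apply/eqP; rewrite -subr_eq0; apply/eqP; apply: ndgB => u.
by rewrite form_sym linearBr /= uvw subrr.
Qed.

Lemma gram_sym : gram^T = gram.
Proof. by apply/matrixP => i j; rewrite !mxE form_sym. Qed.

Lemma gram_unit : gram \in unitmx.
Proof.
rewrite -row_free_unit; apply: inj_row_free => v v0.
suff vT0 : v^T = 0 by rewrite -[v]trmxK vT0 trmx0.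
by apply: ndgB => w; rewrite gramE trmxK v0 mul0mx mxE.
Qed.

Lemma form_adjoint T v w : B (T *m v) w = B v (adjoint T *m w).
Proof. by rewrite !gramE trmx_mul /adjoint !mulmxA mulmxK ?gram_unit. Qed.

Lemma adjointP T X : (forall v w, B (T *m v) w = B v (X *m w)) -> adjoint T = X.
Proof.
by move=> TX; apply: mulmx_ext => w; apply: form_ext => v; rewrite -form_adjoint TX.
Qed.

Lemma adjoint_parity : adjoint s = - s.
Proof. by apply: adjointP => v w; rewrite form_parity_mx mulNmx linearNr. Qed.

Lemma pe_even X : homog false X -> pe B X <-> adjoint X = - X.
Proof.
move=> hX; have X1 := part_other hX; split=> [peX|aX a b v w vb].
  apply: adjointP => v w; rewrite mulNmx linearNr /=.
  have XvB b u : u \in std_gr K n b -> B (X *m u) w = - B u (X *m w).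
    move=> ub; have /eqP := peX false b u w ub.
    by rewrite hX expr0 mul1r addr_eq0 => /eqP.
  have : v \in (std_gr K n false + std_gr K n true)%VS by rewrite std_gr_add memvf.
  case/memv_addP => v0 /XvB E0 [v1 /XvB E1 ->].
  by rewrite mulmxDr !linearDl /= E0 E1 opprD.
case: a; first by rewrite X1 !mul0mx linear0l linear0r mulr0 addr0.
by rewrite hX expr0 mul1r form_adjoint aX mulNmx linearNr addNr.
Qed.

(** The sign $(-1)^{|v|}$ in the invariance of the form is absorbed by [s], which is skew for
    [B]. *)
Lemma pe_odd X : homog true X -> pe B X -> adjoint X = s * X.
Proof.
move=> hX peX; apply: adjointP => v w.
have XvB b u : u \in std_gr K n b -> B (X *m u) w = B u (s * X *m w).
  move=> ub; have /eqP := peX true b u w ub.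
  rewrite hX /= addr_eq0 => /eqP ->; rewrite -mulmxA -[RHS]opprK -form_parity_mx.
  by move/(mem_std_gr charK): ub => ->; rewrite linearZl_LR.
have : v \in (std_gr K n false + std_gr K n true)%VS by rewrite std_gr_add memvf.
case/memv_addP => v0 /XvB E0 [v1 /XvB E1 ->].
by rewrite mulmxDr !linearDl /= E0 E1.
Qed.

(** * Brackets and the even center of $\mathfrak{spe}(n)$ *)

Lemma sbracket_even X Y : homog false X -> homog false Y ->
  sbracket X Y = X * Y - Y * X.
Proof.
move=> hX hY; have [X1 Y1] : part true X = 0 /\ part true Y = 0.
  by split; [exact: part_other hX | exact: part_other hY].
rewrite /sbracket !big_bool X1 Y1 hX hY /=.
by rewrite !mul0mx !mulmx0 !scaler0 !subr0 expr0 scale1r !add0r.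
Qed.

Lemma sbracket_even_odd X Y : homog false X -> homog true Y ->
  sbracket X Y = X * Y - Y * X.
Proof.
move=> hX hY; have [X1 Y1] : part true X = 0 /\ part false Y = 0.
  by split; [exact: part_other hX | exact: part_other hY].
rewrite /sbracket !big_bool X1 Y1 hX hY /=.
by rewrite !mul0mx !mulmx0 !scaler0 !subr0 expr0 scale1r !add0r addr0.
Qed.

Lemma sbracket_odd X : homog true X -> sbracket X X = 2 *: (X * X).
Proof.
move=> hX; have X0 : part false X = 0 by exact: part_other hX.
rewrite /sbracket !big_bool X0 hX /= !mul0mx !mulmx0 !scaler0 !subr0 !addr0.
by rewrite expr1 scaleN1r opprK scaler_nat mulr2n.
Qed.

Lemma spe_even h : homog false h ->
  spe B h <-> [/\ s * h = h * s, adjoint h = - h & \tr (s * h) = 0].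
Proof.
move=> hh; have sh := (homog_even charK h).1 hh; rewrite -str_parity.
split=> [[/(pe_even hh) ah sth] | [_ /(pe_even hh) ph sth]] //.
Qed.

(** For a traceless [X], placed as [T] in the upper left block, $T - T^\ast$ lies in
    $\mathfrak{spe}(n)$; commuting with all of these makes the block [A] of [h] scalar. Skewness and
    zero supertrace give $\operatorname{tr} A = 0$, so $A = 0$, and skewness then kills [D]. *)
Lemma spe_center0 h : center (spe B) h -> homog false h -> h = 0.
Proof.
move=> [gh com] hh; have [sh ah str_h] := (spe_even hh).1 gh.
pose A := ulsubmx h; pose D := drsubmx h.
have Dh : h = block_mx A 0 0 D by rewrite -{1}hh.
have sblock (X : 'M[K]_n) (T := block_mx X 0 0 0 : 'M[K]_(n + n)) : s * T = T /\ T * s = T.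
  rewrite -[s * T]/(s *m T) -[T * s]/(T *m s) parity_block !mulmx_block.
  by rewrite !mul0mx !mulmx0 !mul1mx !mulmx1 !addr0.
(* As $s^\ast = -s$, the adjoint moves the upper left block to the lower right one. *)
have adjX (X : 'M[K]_n) (T := block_mx X 0 0 0 : 'M[K]_(n + n)) :
    exists Y : 'M[K]_n, adjoint T = block_mx 0 0 0 Y.
  have [sT Ts] := sblock X; rewrite -/T in sT Ts.
  have as1 : - s * adjoint T = adjoint T.
    by rewrite -adjoint_parity -adjointM ?gram_unit // Ts.
  have as2 : adjoint T * - s = adjoint T.
    by rewrite -adjoint_parity -adjointM ?gram_unit // sT.
  move: as1 as2; rewrite -[_ * adjoint T]/(_ *m _) -[adjoint T * _]/(_ *m _).
  rewrite -[adjoint T]submxK parity_block opp_block_mx !oppr0 opprK !mulmx_block.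
  rewrite !mul0mx !mulmx0 !mulNmx !mulmxN !mul1mx !mulmx1 !addr0 !add0r.
  move=> /eq_block_mx [/oppr_self-> // /oppr_self-> // _ _].
  by move=> /eq_block_mx [_ _ /oppr_self-> // _]; exists (drsubmx (adjoint T)).
have comA (X : 'M[K]_n) : \tr X = 0 -> A *m X = X *m A.
  move=> trX; pose T := block_mx X 0 0 0 : 'M[K]_(n + n).
  have [Y aT] := adjX X.
  have hT : homog false (T - adjoint T).
    rewrite aT /homog /= opp_block_mx add_block_mx.
    by rewrite !oppr0 !addr0 add0r block_mxKul block_mxKdr.
  have /com : spe B (T - adjoint T).
    apply/spe_even => //; split.
    - exact/homog_even.
    - by rewrite adjointB adjointK ?gram_unit ?gram_sym // opprB.
    - rewrite (str_skew gram_sym gram_unit adjoint_parity) (sblock X).1.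
      by rewrite mxtrace_block trX mxtrace0 addr0 mulr0.
  rewrite sbracket_even // aT Dh => /eqP; rewrite subr_eq0.
  rewrite opp_block_mx add_block_mx !oppr0 !addr0 add0r.
  rewrite -[_ * _]/(_ *m _) -[X in _ == X]/(_ *m _) !mulmx_block !mul0mx !mulmx0 !addr0.
  by move=> /eqP/eq_block_mx [].
have trA : \tr A = 0.
  have trh : \tr h = 0.
    have := mxtrace_adjoint gram_unit h; rewrite ah raddfN /= => /eqP.
    rewrite -subr_eq0 -opprD oppr_eq0 -mulr2n -mulr_natl mulf_eq0.
    by rewrite (negPf (two_neq0 charK)) => /eqP.
  move: str_h trh; rewrite -str_parity /str -/A -/D {1}Dh mxtrace_block => /eqP.
  rewrite subr_eq0 => /eqP <- /eqP; rewrite -mulr2n -mulr_natl mulf_eq0.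
  by rewrite (negPf (two_neq0 charK)) => /eqP.
have A0 : A = 0.
  clearbody A D.
  (* Off-diagonal matrix units are traceless and already force [A] to be scalar. *)
  have comD i j k l : i != j -> A k i * (l == j)%:R = (k == i)%:R * A j l.
    move=> ij; have trd : \tr (delta_mx i j : 'M[K]_n) = 0.
      rewrite /mxtrace big1 // => m _; rewrite mxE.
      by case: (m =P i) => [->|//]; rewrite (negPf ij).
    have /matrixP/(_ k l) := comA _ trd; rewrite !mxE.
    rewrite (bigD1 i) //= big1 => [|m mi]; last by rewrite mxE (negPf mi) mulr0.
    rewrite [in X in _ = X](bigD1 j) //= [in X in _ = X]big1 => [|m mj]; last first.
      by rewrite mxE (negPf mj) andbF mul0r.
    by rewrite !mxE !eqxx andbT !addr0.
  have diagA i j : A i i = A j j.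
    have [->//|ij] := eqVneq i j.
    by have := comD i j i j ij; rewrite !eqxx mulr1 mul1r.
  apply/matrixP => i j; rewrite mxE; have [<-|ij] := eqVneq i j; last first.
    by have := comD j i i i; rewrite eqxx (negPf ij) mulr1 mul0r; apply; rewrite eq_sym.
  move: trA; rewrite /mxtrace (eq_bigr (fun=> A i i)) => [|k _]; last exact: diagA.
  rewrite sumr_const card_ord -mulr_natl => /eqP; rewrite mulf_eq0.
  have /pcharf0P -> := charK; case/orP => [/eqP n0|/eqP //].
  by have := leq_ltn_trans (leq0n i) (ltn_ord i); rewrite [X in (_ < X)%N]n0.
(* With $A = 0$, [h] lives on the odd part, so $sh = hs = -h$; taking adjoints gives $h = -h$. *)
have hs : h * s = - h.
  rewrite Dh A0 -[_ * s]/(_ *m s) parity_block mulmx_block.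
  by rewrite !mul0mx !mulmx0 !mulmxN mulmx1 opp_block_mx !oppr0 !addr0 add0r.
have : adjoint (s * h) = adjoint h * - s.
  by rewrite adjointM ?gram_unit // adjoint_parity.
rewrite sh hs adjointN ah opprK mulrNN hs => /esym.
exact: oppr_self.
Qed.

Variables (x : 'M[K]_(n + n)) (hx : homog true x).
Hypothesis pex : pe B x.
Local Notation V := (std_mod hx).

Lemma adjoint_x : adjoint x = s * x.
Proof. exact: pe_odd. Qed.

(** * The image of the adjoint idempotent as a shifted dual *)

Section DualSummand.
Variables (U U' : submod V) (f : 'M[K]_(n + n)).
Hypothesis prU : projects f (sm_space U).
Hypothesis prU' : projects (adjoint f) (sm_space U').

Lemma sub_parity_gr_proj (u : subvs_of (sm_space U)) :
  gr_proj (kx_sub U) false u - gr_proj (kx_sub U) true u = sub_parity u.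
Proof.
have sa : sub_parity (gr_proj (kx_sub U) false u) = gr_proj (kx_sub U) false u.
  have /(mem_sub_gr_parity charK) -> := @gr_proj_mem K (kx_sub U) false u.
  by rewrite expr0 scale1r.
have sb : sub_parity (gr_proj (kx_sub U) true u) = - gr_proj (kx_sub U) true u.
  have /(mem_sub_gr_parity charK) -> := @gr_proj_mem K (kx_sub U) true u.
  by rewrite expr1 scaleN1r.
have := sub_parityD charK (gr_proj (kx_sub U) false u) (gr_proj (kx_sub U) true u).
by rewrite sa sb => <-; congr (sub_parity _); exact: (@gr_proj_add K (kx_sub U) u).
Qed.

Lemma dual_act_parity (phi : 'Hom(kx_sub U, (K^o : vectType K))) (u : kx_sub U) :
  dual_act (kx_sub U) phi u = - phi (sub_parity (sub_act U u)).
Proof.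
rewrite lfunE /= comp_lfunE opp_lfunE linearN /=; congr (- _).
rewrite comp_lfunE add_lfunE opp_lfunE; congr (phi _).
exact: sub_parity_gr_proj.
Qed.

Definition form_functional (w : cV) : 'Hom(kx_sub U, (K^o : vectType K)) :=
  linfun (fun u : kx_sub U => B (vsval u) w : K^o).

Lemma form_functionalE w (u : subvs_of (sm_space U)) : form_functional w u = B (vsval u) w.
Proof.
have lg : linear (fun u : kx_sub U => B (vsval u) w : K^o).
  by move=> a v z; rewrite vsval_linear linearPl.
pose gL := GRing.isLinear.Build K (kx_sub U) K^o _ _ lg.
pose gl : {linear kx_sub U -> K^o} := HB.pack (fun u : kx_sub U => B (vsval u) w : K^o) gL.
by rewrite /form_functional (lfunE gl).
Qed.

(* The isomorphism maps w in U' to the functional B(-, w) on U. *)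
Lemma dual_summand : kx_iso (kx_sub U') (kx_pi (kx_dual (kx_sub U))).
Proof.
pose D : vectType K := 'Hom(kx_sub U, (K^o : vectType K)).
pose g (w : subvs_of (sm_space U')) : D := form_functional (vsval w).
have lg : linear g.
  move=> a w z; apply/lfunP => u; rewrite add_lfunE scale_lfunE !form_functionalE.
  by rewrite vsval_linear linearPr.
pose gL := GRing.isLinear.Build K (kx_sub U') D _ g lg.
pose gl : {linear kx_sub U' -> D} := HB.pack g gL.
have FE (w : kx_sub U') (u : kx_sub U) : (linfun gl : 'Hom(kx_sub U', D)) w u = B (vsval u) (vsval w).
  by rewrite lfunE form_functionalE.
have Finj (w z : kx_sub U') : (linfun gl : 'Hom(kx_sub U', D)) w = (linfun gl : 'Hom(kx_sub U', D)) z -> w = z.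
  move=> Fwz; apply: subvs_inj; apply: form_ext => u.
  rewrite -(projects_vsval w prU') -(projects_vsval z prU') -!form_adjoint.
  by rewrite -(projects_vsproj u prU) -!FE Fwz.
exists (linfun gl); split.
(* The inverse map: [psi phi] lists the values of [phi] after the projection [f], [invmx gram] turns
   them into a representing vector, and [adjoint f] projects it to [U']. *)
- pose psi (phi : D) : 'cV[K]_(n + n) :=
    \col_i phi (vsproj (sm_space U) (f *m delta_mx i 0)).
  pose G (phi : D) : subvs_of (sm_space U') :=
    vsproj (sm_space U') (adjoint f *m (invmx gram *m psi phi)).
  have FG phi : (linfun gl : 'Hom(kx_sub U', D)) (G phi) = phi.
    apply/lfunP => u; rewrite FE projects_vsproj // -form_adjoint (projects_vsval u prU).
    rewrite gramE !mulmxA mulmxK ?gram_unit //.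
    pose L (v : cV) : K := phi (vsproj (sm_space U) (f *m v)).
    have LP a v w : L (a *: v + w) = a * L v + L w.
      rewrite /L mulmxDr -scalemxAr vsproj_linear; exact: (linearP phi).
    have L0 : L 0 = 0 by have := LP (-1) 0 0; rewrite scaler0 addr0 mulN1r addNr.
    have LD v w : L (v + w) = L v + L w by have := LP 1 v w; rewrite scale1r mul1r.
    have LZ a v : L (a *: v) = a * L v by have := LP a v 0; rewrite L0 !addr0.
    have -> : phi u = L (vsval u) by rewrite /L (projects_vsval u prU) vsvalK.
    rewrite [in RHS](col_sum_delta (vsval u)) (big_morph L LD L0) mxE.
    by apply: eq_bigr => i _; rewrite LZ !mxE.
  by exists G => [w|phi]; [apply: Finj; exact: FG | exact: FG].
- move=> w; apply/lfunP => u; rewrite FE.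
  have -> : kx_act (kx_pi (kx_dual (kx_sub U))) (linfun gl w) u =
      (linfun gl : 'Hom(kx_sub U', D)) w (sub_parity (sub_act U u)).
    change (((- dual_act (kx_sub U)) (linfun gl w) : 'Hom(kx_sub U, (K^o : vectType K))) u =
      (linfun gl : 'Hom(kx_sub U', D)) w (sub_parity (sub_act U u))).
    by rewrite opp_lfunE [LHS]opp_lfunE dual_act_parity opprK.
  rewrite FE.
  (* The signs from $\Pi$ and from the dual cancel; what remains is $(sx)^\ast = -sxs = x$. *)
  rewrite sub_parityE // !sub_act_mulmx mulmxA -[s *m x]/(s * x) form_adjoint.
  rewrite adjointM ?gram_unit // adjoint_x adjoint_parity mulrN (homog_odd hx) mulNr opprK.
  by rewrite -mulrA parity_sq mulr1.
- move=> b w wb; apply/dual_grP => u; rewrite negbK => ub; rewrite FE.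
  by apply: (oddB (b := b)); [move: ub | move: wb]; rewrite [_ \in _]mem_sub_gr.
Qed.

End DualSummand.

(** * Distinguished elements and the two implications *)

Local Notation even_cent := (even_cent x s).
Local Notation primitive := (primitive x s).
Local Notation mx_equiv := (mx_equiv x s).
Local Notation no_torus := (no_torus x s gram).
Let adjK := adjointK gram_sym gram_unit.
Let adjM := adjointM gram_unit.

Lemma homog0 : homog false (0 : 'M[K]_(n + n)).
Proof. by apply/(homog_even charK); rewrite mul0r mulr0. Qed.

Lemma sbracket0 X : sbracket 0 X = 0.
Proof.
have part0 b : part b (0 : 'M[K]_(n + n)) = 0.
  by case: b; [exact: part_other homog0 | exact: homog0].
rewrite /sbracket big1 // => a _; rewrite big1 // => b _.
by rewrite part0 mul0mx mulmx0 scaler0 subr0.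
Qed.

(** Both sides of the defining equivalence hold for $h = 0$, and the central side forces $h = 0$; so
    only the other side matters. *)
Lemma distinguished_no_torus : distinguished (spe B) x <-> no_torus.
Proof.
have h0 := homog0; have spe0 : spe B 0.
  by apply/spe_even => //; rewrite mul0r mulr0 mxtrace0 adjoint0 oppr0.
split=> [D h [xh sh] ah str_h dh | D h].
  have hh : homog false h by exact/homog_even.
  have /D [ch _] : [/\ spe B h, homog false h, diagonalizable h & sbracket h x = 0].
    by split=> //; [exact/spe_even | rewrite sbracket_even_odd // xh subrr].
  exact: spe_center0.
suff hz : [/\ spe B h, homog false h, diagonalizable h & sbracket h x = 0]
    \/ center (spe B) h /\ homog false h -> h = 0.
  split=> hP.
    have -> : h = 0 by apply: hz; left.
    by split=> //; split=> // y _; exact: sbracket0.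
  have -> : h = 0 by apply: hz; right.
  by split=> //; [exact: diagonalizable0 | exact: sbracket0].
case=> [[gh hh dh hx0]|[ch hh]]; last exact: spe_center0.
have [sh ah str_h] := (spe_even hh).1 gh; apply: D => //; split=> //.
by apply/eqP; rewrite eq_sym -subr_eq0 -sbracket_even_odd // hx0.
Qed.

Lemma projects_rank e (A : {vspace cV}) : projects e A -> \rank e = \dim A.
Proof.
move=> prA; apply: (natr_inj charK); rewrite -(projects_trace prA) idem_trace //.
exact: projects_idem prA.
Qed.

Lemma orthogonal_adjoint e f (A C : {vspace cV}) : projects e A -> projects f C ->
  orthogonal_spaces B A C <-> adjoint e * f = 0.
Proof.
move=> [eA Ae] [fC Cf]; split=> [AC|ef u w uA wC].
  apply: mulmx_ext => w; rewrite mul0mx; apply: form_ext => u.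
  by rewrite -[adjoint e * f *m w]mulmxA -form_adjoint linear0r; apply: AC.
rewrite -(Ae u uA) -(Cf w wC) form_adjoint mulmxA -[adjoint e *m f]/(adjoint e * f) ef.
by rewrite mul0mx linear0r.
Qed.

(** Orthogonality makes the projections onto the [U i] self-adjoint and those onto the two halves of
    [W] adjoint to each other. So [decomposition_nilp] shows [h] nilpotent; being diagonalizable, it
    is 0. *)
Lemma decomposition_no_torus : distinguished_decomposition B hx -> no_torus.
Proof.
case=> p [U [W [[sumUW dirUW] [orthU orthW] [nisoU _] indU hW]]].
(* An absent [W] is treated along with the other case by taking both halves to be the zero space
   [W]. *)
have [W' [W'' [WW dirW isoW hW']]] : exists W' W'' : submod V,
    [/\ (sm_space W' + sm_space W'')%VS = sm_space W,
        directv (sm_space W' + sm_space W''),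
        isotropic B (sm_space W') /\ isotropic B (sm_space W'')
      & sm_space W' = 0%VS \/ [/\ indecomposable (kx_sub W'),
          indecomposable (kx_sub W'') & odd (\dim (sm_space W'))]].
  case: hW => [W0|[W' [W'' [[WW dirW] _ oddW isoW [ind' ind'']]]]]; last first.
    by exists W', W''; split=> //; right.
  have iso0 : isotropic B (sm_space W).
    by move=> u w; rewrite W0 !memv0 => /eqP -> _; exact: linear0l.
  exists W, W; split=> //; [by rewrite addvv | | by left].
  by rewrite directvE /= addvv W0 dimv0.
pose Us (i : 'I_p + bool) : submod V := match i with
  | inl i => U i | inr b => if b then W'' else W' end.
have sumUs : (\sum_i sm_space (Us i))%VS = fullv.
  by rewrite big_sumType big_bool /= [(W'' + W')%VS]addvC WW.
have dirUs : directv (\sum_i sm_space (Us i)).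
  rewrite directvE /= sumUs big_sumType big_bool /= -sumUW.
  move: dirUW dirW; rewrite !directvE /= WW => /eqP -> /eqP ->.
  by rewrite [(\dim (sm_space W'') + _)%N]addnC.
have [E [prE sumE comE]] := directv_projections sumUs dirUs.
have cE i : even_cent (E i).
  by split; apply: comE => j v; [exact: submod_act | exact: submod_parity].
have orth i j : orthogonal_spaces B (sm_space (Us i)) (sm_space (Us j)) ->
    adjoint (E i) * E j = 0.
  exact: (orthogonal_adjoint (prE i) (prE j)).1.
have inW b v : v \in sm_space (Us (inr b)) -> v \in sm_space W.
  by rewrite -WW; case: b => vb; [exact: (subvP (addvSr _ _)) | exact: (subvP (addvSl _ _))].
have orthUU i j : i != j -> adjoint (E (inl i)) * E (inl j) = 0.
  by move=> ij; apply: orth; exact: orthU.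
have orthUW i b : adjoint (E (inl i)) * E (inr b) = 0.
  by apply: orth => u w uU /inW wW; exact: orthW uU wW.
have orthWU i b : adjoint (E (inr b)) * E (inl i) = 0.
  by rewrite -[E (inl i)]adjK -adjM orthUW adjoint0.
have orthWW b : adjoint (E (inr b)) * E (inr b) = 0.
  by apply: orth; case: b; [case: isoW | case: isoW].
have adjE i : adjoint (E i) = \sum_j adjoint (E i) * E j by rewrite -mulr_sumr sumE [RHS]mulr1.
(* Expanding $E_i^\ast$ along $\sum_j E_j = 1$, only $E_i^\ast E_i$ survives, and it is
   self-adjoint. *)
have selfE i : adjoint (E (inl i)) = E (inl i).
  have DE : adjoint (E (inl i)) = adjoint (E (inl i)) * E (inl i).
    rewrite {1}adjE big_sumType big_bool /= !orthUW !addr0 (bigD1 i) //= big1 ?addr0 // => j ij.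
    by rewrite orthUU // eq_sym.
  by rewrite -[RHS]adjK {2}DE adjM adjK -DE.
(* In the same expansion isotropy kills the term of the same half. *)
have adjW b : adjoint (E (inr b)) = adjoint (E (inr b)) * E (inr (~~ b)).
  rewrite {1}adjE big_sumType big_bool /= big1 => [|j _]; last exact: orthWU.
  by case: b; rewrite orthWW !add0r ?addr0.
have adjf : adjoint (E (inr false)) = E (inr true).
  by rewrite [LHS]adjW -[RHS]adjK (adjW true) adjM adjK.
have indP i : indecomposable (kx_sub (Us i)) -> primitive (E i).
  exact: (indecomposable_primitive charK (prE i) (cE i)).1.
have rkE i : \rank (E i) = \dim (sm_space (Us i)) by exact: projects_rank.
move=> h ch ah str_h dh.
have [|||||||k hk] := @decomposition_nilp _ _ x s gram charK (parity_sq K n) gram_sym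
    gram_unit adjoint_parity p (fun i => E (inl i)) (E (inr false)) h.
- by move=> i; have [ind ev] := indU i; rewrite rkE; split=> //; exact: (indP (inl i)).
- move=> i j ij /(kx_iso_equiv charK (prE (inl i)) (prE (inl j)) (cE _) (cE _)).
  exact: nisoU.
- case: hW' => [W0|[i1 i2 oddW]]; [left | right].
    apply: mulmx_ext => v; rewrite mul0mx; apply/eqP.
    by rewrite -memv0 -W0; exact: (prE (inr false)).1.
  by rewrite adjf rkE; split=> //; [exact: (indP (inr false)) | exact: (indP (inr true))].
- by rewrite adjf -[RHS]sumE big_sumType big_bool /= [X in _ + X]addrC.
- by [].
- by [].
- by [].
exact: diagonalizable_nilp dh hk.
Qed.

Lemma primitive_adjoint f : primitive f -> primitive (adjoint f).
Proof.
have cadj := adjoint_even_cent (parity_sq K n) gram_unit adjoint_x adjoint_parity.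
move=> [f0 cf ff prim]; split=> [|||g [cg fg gf] gg].
- by apply: contra f0 => /eqP af0; rewrite -[f]adjK af0 adjoint0.
- exact: cadj.
- by rewrite -adjM ff.
have [||ag|ag] := prim (adjoint g).
- by split; [exact: cadj | rewrite -[f]adjK -adjM gf | rewrite -[f]adjK -adjM fg].
- by rewrite -adjM gg.
- by left; rewrite -[g]adjK ag adjoint0.
- by right; rewrite -ag adjK.
Qed.

(** An equivalence would carry [f] to an idempotent of $eCe$, which is 0 or [e]; this means $f = 0$
    or $g = 0$. If both vanish, then $e = 0$. *)
Lemma primitive_nonequiv_pair e f g : primitive e -> f = 0 /\ g = 0 \/ primitive f /\ primitive g ->
  f * g = 0 -> g * f = 0 -> ~ mx_equiv e (f + g).
Proof.
move=> [e0 _ _ prim] fg0 fg gf [a [b [[ca cb] [ea aF] [Fb be] ab ba]]].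
case: fg0 => [[f0 g0]|[[f0 cf ff _] [g0 _ gg _]]].
  by case/eqP: e0; rewrite -ab -aF f0 g0 addr0 mulr0 mul0r.
have Ff : (f + g) * f = f by rewrite mulrDl ff gf addr0.
have fF : f * (f + g) = f by rewrite mulrDr ff fg addr0.
have bafba : b * (a * f * b) * a = f by rewrite !mulrA ba -!mulrA ba fF Ff.
case: (prim (a * f * b)) => [||afb|afb].
- split; first by do 2?apply: even_centM.
    by rewrite !mulrA ea.
  by rewrite -!mulrA be.
- by rewrite -!mulrA (mulrA b a) ba (mulrA (f + g)) Ff (mulrA f) ff.
- by case/eqP: f0; rewrite -bafba afb mulr0 mul0r.
- case/eqP: g0; have : f = f + g by rewrite -{1}bafba afb be ba.
  by move/eqP; rewrite -subr_eq0 opprD addrA subrr sub0r oppr_eq0 => /eqP.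
Qed.

Lemma submod_of_idem e : even_cent e -> e * e = e ->
  exists U : submod V, sm_space U = mximg e /\ projects e (sm_space U).
Proof.
move=> [xe se] ee; have prE := projects_mximg ee.
have stable y : y * e = e * y -> forall v, v \in mximg e -> y *m v \in mximg e.
  move=> ye v; rewrite !(projects_mem _ prE) => /eqP ev.
  by rewrite mulmxA -[e *m y]/(e * y) -ye -[y * e *m v]mulmxA ev.
have [U DU] := exists_submod hx charK (stable x xe) (stable s se).
by exists U; rewrite DU.
Qed.

Lemma nilpotent_x : ad_nilpotent x -> exists k, x ^+ k = 0.
Proof.
move=> [k xk]; exists (2 * k)%N; apply/eqP.
have scaleX m : (2 *: (x * x)) ^+ m = 2 ^+ m *: (x ^+ (2 * m)).
  elim: m => [|m IHm]; first by rewrite muln0 !expr0 scale1r.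
  by rewrite mulnS exprD expr2 !exprS IHm mxscaleAl mxscaleAr scalerA.
move/eqP: xk; rewrite sbracket_odd // scaleX scaler_eq0 expf_eq0.
by rewrite (negPf (two_neq0 charK)) andbF.
Qed.

(** The summands are the images of the idempotents from [no_torus_decomposition], with [W] the image
    of $f + f^\ast$. *)
Lemma no_torus_distinguished_decomposition : ad_nilpotent x -> no_torus ->
  distinguished_decomposition B hx.
Proof.
move=> /nilpotent_x [k xk] D.
have cadj := adjoint_even_cent (parity_sq K n) gram_unit adjoint_x adjoint_parity.
have [l [f [[suml orthl inl] nequiv [cf ff faf aff] hf]]] := no_torus_decomposition charK
  (parity_sq K n) gram_sym gram_unit adjoint_x adjoint_parity D.
pose E (i : 'I_(size l)) := l`_i.
have inE_ i : E i \in l by rewrite mem_nth.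
have primE i : primitive (E i) by have [] := inl _ (inE_ i).
have adjE i : adjoint (E i) = E i by have [] := inl _ (inE_ i).
have cE i : even_cent (E i) by have [] := primE i.
have EE i : E i * E i = E i by have [] := primE i.
have orthE i j : i != j -> orthogonal_idem (E i) (E j).
  wlog ij : i j / (i < j)%N => [W nij|_].
    case: (ltngtP i j) => [/W -> //|ji|/val_inj ij]; last by rewrite ij eqxx in nij.
    by rewrite /orthogonal_idem andbC; apply: W; rewrite // eq_sym.
  by move/(pairwiseP 0): orthl; apply; rewrite ?inE.
pose F := f + adjoint f.
have cF : even_cent F by apply: even_centD => //; exact: cadj.
have afaf : adjoint f * adjoint f = adjoint f by rewrite -adjM ff.
have FF : F * F = F by rewrite mulrDl !mulrDr ff faf aff afaf addr0 add0r.
have sumE : \sum_i E i + F = 1 by rewrite -suml (big_nth 0) big_mkord.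
have /fin_all_exists [U hU] : forall i, exists U : submod V,
    sm_space U = mximg (E i) /\ projects (E i) (sm_space U).
  by move=> i; exact: submod_of_idem.
have prE i : projects (E i) (sm_space (U i)) by have [] := hU i.
have [W [DW prW]] := submod_of_idem cF FF.
have pff : f = 0 /\ adjoint f = 0 \/ primitive f /\ primitive (adjoint f).
  case: hf => [->|[pf _]]; [left | right]; first by rewrite adjoint0.
  by split=> //; exact: primitive_adjoint.
exists (size l), U, W; split.
- have sumUW : (\sum_(i < size l) sm_space (U i) + sm_space W)%VS = fullv.
    apply/eqP; rewrite eqEsubv subvf /=; apply/subvP => v _.
    rewrite -[v]mul1mx -[1%:M]/(1 : 'M_(n + n)) -sumE mulmxDl mulmx_suml.
    apply: memv_add; last exact: prW.1.
    by apply: memv_sumr => i _; exact: (prE i).1.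
  (* Directness by counting: dimensions are traces of the projections, which add up to the trace of
     1. *)
  split=> //; rewrite directvE /= sumUW; apply/eqP/(natr_inj charK).
  have pr1 : projects (1%:M : 'M[K]_(n + n)) fullv.
    by split=> v; rewrite ?mul1mx // memvf.
  rewrite natrD natr_sum -(projects_trace pr1) -(projects_trace prW) -[1%:M]/(1 : 'M_(n + n)).
  rewrite -sumE raddfD raddf_sum /=; congr (_ + _); apply: eq_bigr => i _.
  exact: projects_trace.
- split=> [i j ij|i].
    apply/(orthogonal_adjoint (prE i) (prE j)); rewrite adjE.
    by case/andP: (orthE i j ij) => /eqP.
  apply/(orthogonal_adjoint (prE i) prW); rewrite adjE mulrDr.
  by have [_ _ [-> _ -> _]] := inl _ (inE_ i); rewrite addr0.
- split=> [i j ij|i].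
    move/(kx_iso_equiv charK (prE i) (prE j) (cE i) (cE j)); apply: nequiv => //.
    exact: orthE.
  move/(kx_iso_equiv charK (prE i) prW (cE i) cF).
  exact: primitive_nonequiv_pair.
- move=> i; split; first exact/(indecomposable_primitive charK (prE i) (cE i)).
  rewrite -(projects_rank (prE i)).
  (* The adjoint negates the supertrace, so a self-adjoint [E i] has supertrace 0: even and odd
     dimensions agree and the total is even. *)
  have str0 : \tr (s * E i) = 0.
    have := str_adjoint gram_sym gram_unit adjoint_parity (E i); rewrite adjE => /eqP.
    rewrite -subr_eq0 opprK -mulr2n -mulr_natl mulf_eq0 (negPf (two_neq0 charK)).
    by move=> /eqP.
  have [a Da] := idem_sdim charK (parity_sq K n) (cE i) (EE i).
  by move: Da; rewrite str0 add0r => /(natr_inj charK) ->; rewrite odd_double.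
- case: hf => [f0|[pf strf]]; [left | right].
    rewrite DW; apply/eqP; rewrite -subv0; apply/subvP => v.
    rewrite (projects_mem _ (projects_mximg FF)) /F f0 adjoint0 addr0 mul0mx memv0 eq_sym.
    by [].
  have [_ paf] : primitive f /\ primitive (adjoint f).
    by split=> //; exact: primitive_adjoint.
  have [W' [DW' prW']] := submod_of_idem cf ff.
  have [W'' [DW'' prW'']] := submod_of_idem (cadj _ cf) afaf.
  exists W', W''; split.
  + split.
      apply/eqP; rewrite eqEsubv subv_add -andbA; apply/and3P; split; apply/subvP => v.
      * rewrite (projects_mem _ prW') (projects_mem _ prW) => /eqP fv.
        by rewrite -fv mulmxA -[F *m f]/(F * f) mulrDl ff aff addr0.
      * rewrite (projects_mem _ prW'') (projects_mem _ prW) => /eqP fv.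
        by rewrite -fv mulmxA -[F *m adjoint f]/(F * adjoint f) mulrDl faf afaf add0r.
      * rewrite (projects_mem _ prW) => /eqP <-; rewrite mulmxDl.
        by apply: memv_add; [exact: prW'.1 | exact: prW''.1].
    apply/directv_addP/eqP; rewrite -subv0; apply/subvP => v /memv_capP [].
    rewrite (projects_mem _ prW') (projects_mem _ prW'') memv0 => /eqP fv /eqP afv.
    by rewrite -fv -afv mulmxA -[f *m adjoint f]/(f * adjoint f) faf mul0mx.
  + exact: dual_summand prW' prW''.
  + rewrite -(projects_rank prW').
    (* The nilpotency of [x] enters here. *)
    exact: (primitive_odd_rank charK (erefl (parity_mx K n)) (homog_odd hx) xk pf strf).
  + split; [apply/(orthogonal_adjoint prW' prW') | apply/(orthogonal_adjoint prW'' prW'')].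
      exact: aff.
    by rewrite adjK.
  + by split; [apply/(indecomposable_primitive charK prW' cf)
      | apply/(indecomposable_primitive charK prW'' (cadj _ cf))].
Qed.

End OddForm.

Theorem lemma7p4p10 (K : closedFieldType) (charK : [pchar K] =i pred0)
    (n : nat) (B : {biscalar 'cV[K]_(n + n)})
    (oddB : odd_form B) (symB : supersymmetric_form B)
    (ndgB : nondegenerate_form B)
    (x : 'M[K]_(n + n)) (xg : spe B x) (hx : homog true x)
    (xnil : ad_nilpotent x) :
  distinguished (spe B) x <-> distinguished_decomposition B hx.
Proof.
have [pex _] := xg.
have D := distinguished_no_torus charK oddB symB ndgB hx.
split=> [/D|] dx.
  exact: (no_torus_distinguished_decomposition charK oddB symB ndgB hx pex xnil dx).
by apply/D; exact: decomposition_no_torus dx.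
Qed.
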